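(* Let $L$ be a Lie superalgebra and $M$ a nonzero finite-dimensional $L$-supermodule over $\mathbb F$, $n\ge2$, $d_{\bar0}=\dim M_{\bar0}$, $d_{\bar1}=\dim M_{\bar1}$, $d=d_{\bar0}+d_{\bar1}$. Assume $n\le d_{\bar1}$ if $d_{\bar0}=0$, and $\operatorname{char}\mathbb F=0$ or $\operatorname{char}\mathbb F>n$ if $d_{\bar0}>0$. Let $\{v_i\}_{i=1}^d$ be a basis of $M$ with $v_1,\dots,v_{d_{\bar0}}$ a basis of $M_{\bar0}$ and $v_{d_{\bar0}+1},\dots,v_d$ a basis of $M_{\bar1}$, and let $\{f_i\}_{i=1}^d$ be the dual basis of $M^*$. For $I=(i_1,\dots,i_n)\in\check{\mathcal I}_n$ put $\check e_I=v_{i_1}\vee\dots\vee v_{i_n}$ and $\check e^*_I=f_{i_1}\vee\dots\vee f_{i_n}$. Then: (a) $\check F(\check e^*_I,\check e_J)=\kappa_I\delta_{I,J}$ for all $I,J\in\check{\mathcal I}_n$. (b) $\check F\colon\bigvee^nM^*\times\bigvee^nM\to\mathbb F$ is nondegenerate, and $\{\check e_I\}_{I\in\check{\mathcal I}_n}$ and $\{\check e^*_I\}_{I\in\check{\mathcal I}_n}$ are bases of $\bigvee^nM$ and $\bigvee^nM^*$, respectively. (c) $\dim\bigvee^nM=\sum_{k=0}^{\min(d_{\bar1},n)}\binom{d_{\bar1}}{k}\binom{d_{\bar0}+(n-k)-1}{n-k}$. (d) $\check F$ is a dual pairing of $L$-supermodules; it defines an isomorphism of $L$-supermodules $\bigvee^nM^*\cong(\bigvee^nM)^*$,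 $f\mapsto\check F(f,\cdot)$.
   Context: $\mathbb F$ is a field with $\operatorname{char}\mathbb F\neq2$. Vector superspaces are $\mathbb Z_2$-graded, with parity $\varepsilon$ and $\eta_{x,y}=(-1)^{\varepsilon(x)\varepsilon(y)}$. ''Lie superalgebra'' means a superalgebra with $[x,y]=-\eta_{x,y}[y,x]$ and $[x,[y,z]]=[[x,y],z]+\eta_{x,y}[y,[x,z]]$; supermodules satisfy $[x,y]\cdot v=x\cdot(y\cdot v)-\eta_{x,y}y\cdot(x\cdot v)$ and respect the grading. The dual supermodule $M^*$ has action $\langle x\cdot f,v\rangle=-\eta_{x,f}\langle f,x\cdot v\rangle$, where $\langle f,v\rangle=f(v)$; a bilinear pairing $G\colon P\times N\to\mathbb F$ is a pairing of $L$-supermodules if $G(x\cdot f,v)=-\eta_{x,f}G(f,x\cdot v)$, and a dual pairing if moreover nondegenerate. $S_n$ acts on $M^{\otimes n}$ with $(i\ \,i{+}1)$ acting by $v_1\otimes\dots\otimes v_n\mapsto\eta_{v_i,v_{i+1}}v_1\otimes\dots\otimes v_{i+1}\otimes v_i\otimes\dots\otimes v_n$ on homogeneous tensors (similarly on $(M^* )^{\otimes n}$). $\bigvee^nM$ is the quotient of $M^{\otimes n}$ by the span of all $v-\sigma\cdot v$; $\vee_iv_i$ is the class of $\otimes_iv_i$; $L$ acts by $x\cdot(\vee_iv_i)=\sum_i(\prod_{k<i}\eta_{x,v_k})v_1\vee\dots\vee(x\cdot v_i)\vee\dots\vee v_n$. With $\langle\otimes_if_i,\otimes_jv_j\rangle=(\prod_{j<i}\eta_{f_i,v_j})\prod_i\langle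 f_i,v_i\rangle$ on $(M^* )^{\otimes n}\times M^{\otimes n}$, the form $F(f,v)=\sum_{\sigma\in S_n}\langle f,\sigma\cdot v\rangle$ induces the bilinear form $\check F\colon\bigvee^nM^*\times\bigvee^nM\to\mathbb F$. $\check{\mathcal I}_n$ is the set of tuples $I=(i_1,\dots,i_n)$ such that for some $k$ with $0\le n-k\le\min(d_{\bar1},n)$: $1\le i_1\le\dots\le i_k\le d_{\bar0}<i_{k+1}<\dots<i_n\le d$. For such $I$, $\kappa_I=\omega_{n-k}\,m_1!\cdots m_t!$, where $\omega_k=(-1)^{k(k-1)/2}$ and $m_1,\dots,m_t$ are the multiplicities of the distinct entries of $I$. Convention: $\binom{m}{0}=1$ for every integer $m$ (including $m=-1$), and $\binom{m-1}{m}=0$ for $m\geq 1$. *)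

(* Defs.v *)
From HB Require Import structures.
From mathcomp Require Import all_boot all_order all_algebra all_fingroup.
From mathcomp Require Import generic_quotient ring_quotient.
Set Implicit Arguments.
Unset Strict Implicit.
Unset Printing Implicit Defensive.
Import GRing.Theory.
Local Open Scope ring_scope.

Section QuotientSpace.
Variables (F : fieldType) (V : vectType F) (U : {vspace V}).
Local Open Scope quotient_scope.

Definition quotv := @Quotient.quot V (pred_of_vspace U).
HB.instance Definition _ := GRing.Zmodule.on quotv.

Definition vpi : V -> quotv := @pi V (@Quotient.quot V (pred_of_vspace U)).
Definition vrepr : quotv -> V := @repr V (@Quotient.quot V (pred_of_vspace U)).

Lemma vreprK : cancel vrepr vpi.
Proof. exact: reprK. Qed.

Lemma vpi_eq x y : (vpi x == vpi y) = (x - y \in U).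
Proof. by symmetry; apply: (Quotient.idealrBE (pred_of_vspace U)). Qed.

Lemma vrepr_sub x : vrepr (vpi x) - x \in U.
Proof. by rewrite -vpi_eq vreprK. Qed.

Lemma vpiB : zmod_morphism vpi.
Proof. exact: raddfB. Qed.

HB.instance Definition _ := GRing.isZmodMorphism.Build V quotv vpi vpiB.

Definition quotv_scale (a : F) (q : quotv) : quotv := vpi (a *: vrepr q).

Lemma quotv_scaleE a x : quotv_scale a (vpi x) = vpi (a *: x).
Proof. by apply/eqP; rewrite vpi_eq -scalerBr memvZ ?vrepr_sub. Qed.

Fact quotv_scaleA a b q :
  quotv_scale a (quotv_scale b q) = quotv_scale (a * b) q.
Proof. by rewrite -[q]vreprK !quotv_scaleE scalerA. Qed.
Fact quotv_scale1 : left_id 1 quotv_scale.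
Proof. by move=> q; rewrite -[q]vreprK quotv_scaleE scale1r. Qed.
Fact quotv_scaleDr : right_distributive quotv_scale +%R.
Proof.
move=> a q r; rewrite -[q]vreprK -[r]vreprK -raddfD !quotv_scaleE.
by rewrite scalerDr raddfD.
Qed.
Fact quotv_scaleDl q : {morph quotv_scale^~ q : a b / a + b}.
Proof. by move=> a b; rewrite -[q]vreprK !quotv_scaleE scalerDl raddfD. Qed.

HB.instance Definition _ := GRing.Zmodule_isLmodule.Build F quotv
  quotv_scaleA quotv_scale1 quotv_scaleDr quotv_scaleDl.

Lemma vpiZ : scalable vpi.
Proof. by move=> a x; rewrite -[LHS]quotv_scaleE. Qed.

HB.instance Definition _ := GRing.isScalable.Build F V quotv *:%R vpi vpiZ.

Fact quotv_vect_iso : Vector.axiom (\dim (U^C)%VS) quotv.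
Proof.
have dUC : (U^C :&: U = 0)%VS by rewrite capvC capv_compl.
have UCf v : v \in (U^C + U)%VS by rewrite addvC addv_complf memvf.
pose p := daddv_pi (U^C)%VS U.
have pU v : v \in U -> p v = 0.
  move=> Uv; have := daddv_pi_add dUC (UCf v).
  by rewrite (daddv_pi_id (capv_compl U) Uv) => /(canRL (addrK _)); rewrite subrr.
pose c (w : V) := \row_i coord (vbasis (U^C)%VS) i w.
have cP : linear (fun q : quotv => c (p (vrepr q))).
  move=> a q r /=; rewrite -[q]vreprK -[r]vreprK -linearP /=.
  set z := _ + _.
  have E x : p (vrepr (vpi x)) = p x.
    by apply/eqP; rewrite -subr_eq0 -linearB /= pU ?vrepr_sub.
  rewrite !E /z linearP; apply/rowP=> i; rewrite !mxE.
  by rewrite linearP.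
exists (fun q => c (p (vrepr q))) => //.
exists (fun rw : 'rV_(\dim (U^C)%VS) =>
          vpi (\sum_i rw 0 i *: (vbasis (U^C)%VS)`_i)) => [q | rw].
  rewrite -[RHS]vreprK; apply/eqP; rewrite vpi_eq.
  have -> : \sum_i c (p (vrepr q)) 0 i *: (vbasis (U^C)%VS)`_i = p (vrepr q).
    rewrite [RHS](coord_vbasis (memv_pi (U^C)%VS U (vrepr q))).
    by apply: eq_bigr => i _; rewrite mxE.
  have := daddv_pi_add dUC (UCf (vrepr q)); rewrite -/p => e.
  by rewrite -{2}e opprD addrA subrr sub0r memvN memv_pi.
set w := \sum_i _; have wU : w \in (U^C)%VS.
  by apply: rpred_sum => j _; rewrite rpredZ ?vbasis_mem ?memt_nth.
have -> : p (vrepr (vpi w)) = w.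
  rewrite -[RHS](daddv_pi_id dUC wU); apply/eqP.
  by rewrite -subr_eq0 -linearB /= pU ?vrepr_sub.
apply/rowP=> i; rewrite mxE /w.
by rewrite coord_sum_free ?(basis_free (vbasisP _)).
Qed.

HB.instance Definition _ := Lmodule_hasFinDim.Build F quotv quotv_vect_iso.

End QuotientSpace.


Lemma linear_scale (F : fieldType) (U W : lmodType F) (h : U -> W) a x :
  linear h -> h (a *: x) = a *: h x.
Proof.
move=> hL; have h0 : h 0 = 0.
  by have := hL 1 0 0; rewrite !scale1r addr0 -{1}[h 0]addr0 => /addrI.
by have := hL a x 0; rewrite h0 !addr0.
Qed.

Section TensorPower.
Variables (F : fieldType) (n : nat) (M : vectType F).
Local Notation family := {ffun 'I_n -> M}.
Implicit Types (v : family) (i : 'I_n).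

(* [M^{\otimes n}] in coordinates with respect to the basis [vbasis {:M}];
   lemmas [tlift_tens] and [tpow_ext] below are its universal property. *)
Local Notation multi_index := {ffun 'I_n -> 'I_(\dim {:M})}.
Definition tpow := {ffun multi_index -> F^o}.
HB.instance Definition _ := Vector.on tpow.

Definition tens v : tpow :=
  [ffun s : multi_index => \prod_i coord (vbasis {:M}) (s i) (v i)].

Definition upd v i x : family := [ffun k => if k == i then x else v k].

Definition multilinear (W : lmodType F) (f : family -> W) :=
  forall i v, linear (fun x => f (upd v i x)).

Definition tlift (W : lmodType F) (f : family -> W) (t : tpow) : W :=
  \sum_(s : multi_index) t s *: f [ffun i => (vbasis {:M})`_(s i)].

Fact tlift_linear W f : linear (@tlift W f).
Proof.
move=> a t u; rewrite /tlift scaler_sumr -big_split /=.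
by apply: eq_bigr => s _; rewrite !ffunE scalerDl scalerA.
Qed.
HB.instance Definition _ (W : lmodType F) (f : family -> W) := GRing.isLinear.Build F tpow W _ (@tlift W f)
  (tlift_linear f).

Lemma upd_id v i : upd v i (v i) = v.
Proof. by apply/ffunP => k; rewrite ffunE; case: eqP => // ->. Qed.

Lemma multilinear_comb (W : lmodType F) (f : family -> W) i v a x y :
  multilinear f -> f (upd v i (a *: x + y)) = a *: f (upd v i x) + f (upd v i y).
Proof. by move=> /(_ i v a x y). Qed.

Lemma multilinear0 (W : lmodType F) (f : family -> W) i v :
  multilinear f -> v i = 0 -> f v = 0.
Proof.
move=> fL v0; rewrite -(upd_id v i) v0.
have := multilinear_comb i v 1 0 0 fL.
rewrite !scale1r addr0 -{1}[f _]addr0 => /addrI; exact: esym.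
Qed.

Definition gen (S : M -> Prop) := forall P : M -> Prop,
  P 0 -> (forall a x y, P x -> P y -> P (a *: x + y)) ->
  (forall x, S x -> P x) -> forall x, P x.

Lemma multilinear_ext (S : M -> Prop) (W : lmodType F) (f g : family -> W) :
  gen S -> multilinear f -> multilinear g ->
  (forall v, (forall i, S (v i)) -> f v = g v) -> f =1 g.
Proof.
move=> genS fL gL fg v.
have {}fg k : forall v, (forall i, (k <= i)%N -> S (v i)) -> f v = g v.
  elim: k => [|k IHk] {}v Sv; first by apply: fg => i; apply: Sv.
  case: (ltnP k n) => [ltkn | lenk]; last first.
    by apply: IHk => i; rewrite leqNgt (leq_trans (ltn_ord i) lenk).
  pose i := Ordinal ltkn; rewrite -(upd_id v i).
  apply: (genS (fun x => f (upd v i x) = g (upd v i x))) => [|a x y Ex Ey|x Sx].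
  - by rewrite !(@multilinear0 _ _ i) // ffunE eqxx.
  - by rewrite !multilinear_comb // Ex Ey.
  apply: IHk => j le_kj; rewrite ffunE; case: eqP => // /eqP ne_ji.
  by apply: Sv; rewrite ltn_neqAle le_kj andbT eq_sym; exact: ne_ji.
by apply: (fg n) => i; rewrite leqNgt ltn_ord.
Qed.

Lemma gen_vbasis : gen (fun x => exists j : 'I_(\dim {:M}), x = (vbasis {:M})`_j).
Proof.
move=> P P0 PD Pb x; rewrite (coord_vbasis (memvf x)).
elim/big_rec: _ => // j y _ Py; apply: PD => //.
by apply: Pb; exists j.
Qed.

Lemma prod_upd (G : 'I_n -> M -> F) i v x :
  \prod_k G k (upd v i x k) = G i x * \prod_(k | k != i) G k (v k).
Proof.
rewrite (bigD1 i) //= ffunE eqxx; congr (_ * _).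
by apply: eq_bigr => k /negPf ki; rewrite ffunE ki.
Qed.

Lemma multilinear_tens : multilinear tens.
Proof.
move=> i v a x y; apply/ffunP => s; rewrite !ffunE.
rewrite !(prod_upd (fun k => coord (vbasis {:M}) (s k))).
by rewrite linearP mulrDl; congr (_ + _); symmetry; apply: mulrA.
Qed.

Lemma tlift_tens (W : lmodType F) (f : family -> W) v :
  multilinear f -> tlift f (tens v) = f v.
Proof.
move=> fL; pose g u := tlift f (tens u); rewrite -/(g v).
move: v; apply: (multilinear_ext gen_vbasis) => //.
  by move=> i v a x y; rewrite /g multilinear_tens linearP.
move=> v Sv; have [s Es] := fin_all_exists Sv.
rewrite /g /tlift (bigD1 [ffun i => s i]) //= [X in _ + X]big1.
  rewrite addr0 ffunE big1 => [|i _].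
    by rewrite scale1r; congr f; apply/ffunP => i; rewrite !ffunE Es.
  by rewrite ffunE Es coord_free ?eqxx ?(basis_free (vbasisP _)).
move=> t ne_ts; rewrite ffunE.
have [i ne_i]: exists i, t i != s i.
  apply/existsP; apply: contraR ne_ts; rewrite negb_exists => /forallP E.
  by apply/eqP/ffunP => i; rewrite ffunE; apply/eqP; rewrite -[_ == _]negbK.
rewrite (bigD1 i) //= Es coord_free ?(basis_free (vbasisP _)) //.
by rewrite eq_sym (negPf ne_i) mul0r scale0r.
Qed.

Lemma tlift_tensK t : tlift tens t = t.
Proof.
apply/ffunP => s; rewrite /tlift sum_ffunE (bigD1 s) //= big1 => [|r ne_rs].
  rewrite addr0 !ffunE big1 => [|i _]; first exact: mulr1.
  by rewrite ffunE coord_free ?eqxx ?(basis_free (vbasisP _)) .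
rewrite !ffunE; have [i ne_i]: exists i, r i != s i.
  apply/existsP; apply: contraR ne_rs; rewrite negb_exists => /forallP E.
  by apply/eqP/ffunP => i; apply/eqP; rewrite -[_ == _]negbK.
rewrite (bigD1 i) //= ffunE coord_free ?(basis_free (vbasisP _)) //.
rewrite ?[s i == _]eq_sym (negPf ne_i) mul0r; exact: scaler0.
Qed.

Lemma tpow_ext (S : M -> Prop) (W : lmodType F) (g h : {linear tpow -> W}) :
  gen S -> (forall v, (forall i, S (v i)) -> g (tens v) = h (tens v)) -> g =1 h.
Proof.
move=> genS gh t.
have {}gh v : g (tens v) = h (tens v).
  apply: (multilinear_ext (f := g \o tens) (g := h \o tens) genS) => //;
  by move=> i u a x y /=; rewrite multilinear_tens linearP.
rewrite -(tlift_tensK t) /tlift !linear_sum; apply: eq_bigr => s _.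
by rewrite !linearZ gh.
Qed.

End TensorPower.

(* Parities are booleans: [false] is even, [true] is odd. *)
Definition eta (F : fieldType) (b c : bool) : F := (-1) ^+ (b && c).

(* A grading V = V_0 + V_1 (direct sum), given by its two projections. *)
Record grading (F : fieldType) (V : lmodType F) := Grading {
  gproj : bool -> V -> V;
  gproj_linear : forall b, linear (gproj b);
  gprojK : forall b c v, gproj b (gproj c v) = if b == c then gproj c v else 0;
  gproj_sum : forall v, gproj false v + gproj true v = v
}.
HB.instance Definition _ (F : fieldType) (V : lmodType F) (g : grading V) b :=
  GRing.isLinear.Build F V V _ (gproj g b) (gproj_linear g b).

Definition homog (F : fieldType) (V : lmodType F) (g : grading V) b v :=
  gproj g b v = v.

Record superspace (F : fieldType) := Superspace {
  ss_sort :> vectType F;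
  ss_grading :> grading ss_sort
}.

(* [spart V b] is V_b *)
Definition spart (F : fieldType) (V : superspace F) b : {vspace V} :=
  limg (linfun (gproj V b)).
Definition sdim (F : fieldType) (V : superspace F) b := \dim (spart V b).

Definition is_bilinear (F : fieldType) (U V W : lmodType F) (f : U -> V -> W) :=
  (forall v, linear (f^~ v)) /\ (forall u, linear (f u)).

Record lieSuperalgebra (F : fieldType) := LieSuperalgebra {
  lie_sort :> lmodType F;
  lie_grading :> grading lie_sort;
  bracket : lie_sort -> lie_sort -> lie_sort;
  bracket_bilinear : is_bilinear bracket;
  bracket_homog : forall b c x y, homog lie_grading b x ->
    homog lie_grading c y -> homog lie_grading (b (+) c) (bracket x y);
  bracket_skew : forall b c x y, homog lie_grading b x ->
    homog lie_grading c y -> bracket x y = - (eta F b c *: bracket y x);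
  bracket_jacobi : forall b c x y z, homog lie_grading b x ->
    homog lie_grading c y ->
    bracket x (bracket y z) =
      bracket (bracket x y) z + eta F b c *: bracket y (bracket x z)
}.

Record supermodule (F : fieldType) (L : lieSuperalgebra F) := Supermodule {
  sm_space :> superspace F;
  sm_act : L -> sm_space -> sm_space;
  sm_act_bilinear : is_bilinear sm_act;
  sm_act_homog : forall b c x v, homog L b x -> homog sm_space c v ->
    homog sm_space (b (+) c) (sm_act x v);
  sm_act_bracket : forall b c x y v, homog L b x -> homog L c y ->
    sm_act (bracket x y) v =
      sm_act x (sm_act y v) - eta F b c *: sm_act y (sm_act x v)
}.

Section Eta.
Variable F : fieldType.
Lemma eta_sq b c : eta F b c * eta F b c = 1.
Proof. by case: b; case: c; rewrite /eta /= ?expr0 ?mulr1 // expr1 mulrNN mulr1. Qed.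
Lemma etaC b c : eta F b c = eta F c b.
Proof. by rewrite /eta andbC. Qed.
Lemma eta_addl b c d : eta F (b (+) c) d = eta F b d * eta F c d.
Proof.
by case: b; case: c; case: d;
  rewrite /eta /= ?expr0 ?expr1 ?mulr1 ?mul1r // mulrNN mulr1.
Qed.
Lemma eta_addr b c d : eta F d (b (+) c) = eta F d b * eta F d c.
Proof. by rewrite ![eta F d _]etaC eta_addl. Qed.
End Eta.

Section HomogTheory.
Variables (F : fieldType) (V : lmodType F) (g : grading V).

Lemma homog_gproj b v : homog g b (gproj g b v).
Proof. by rewrite /homog gprojK eqxx. Qed.

Lemma gproj_homog b c v : homog g c v -> gproj g b v = if b == c then v else 0.
Proof. by move=> <-; rewrite gprojK; case: eqP => // ->; rewrite gprojK eqxx. Qed.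

Lemma homog0 b : homog g b 0.
Proof. exact: linear0. Qed.

End HomogTheory.

Lemma homog_spart (F : fieldType) (V : superspace F) b v :
  reflect (homog V b v) (v \in spart V b).
Proof.
apply: (iffP memv_imgP) => [[u _ ->]|<-]; first by rewrite lfunE; apply: homog_gproj.
by exists v; rewrite ?memvf ?lfunE.
Qed.

Section HomogeneousLift.
Variables (F : fieldType) (n : nat) (V : superspace F).
Local Notation family := {ffun 'I_n -> V}.
Local Notation parities := {ffun 'I_n -> bool}.
Implicit Types (v : family) (e : parities) (i : 'I_n).

Definition homogs e v := forall i, homog V (e i) (v i).

(* The linear map on [tpow n V] sending [tens v] to [G e v] for every family [v]
   of homogeneous vectors of parities [e] (see [hlift_tens]). *)
Definition hlift (W : lmodType F) (G : parities -> family -> W) : tpow n V -> W :=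
  tlift (fun v => \sum_(e : parities) G e [ffun i => gproj V (e i) (v i)]).

HB.instance Definition _ (W : lmodType F) (G : parities -> family -> W) :=
  GRing.Linear.on (hlift G).

Lemma slotwise_upd (phi : 'I_n -> V -> V) v i x :
  [ffun k => phi k (upd v i x k)] = upd [ffun k => phi k (v k)] i (phi i x).
Proof. by apply/ffunP => k; rewrite !ffunE; case: eqP => [->|]. Qed.

Lemma multilinear_slotwise (W : lmodType F) (f : family -> W)
    (phi : 'I_n -> V -> V) :
  (forall k, linear (phi k)) -> multilinear f ->
  multilinear (fun v => f [ffun k => phi k (v k)]).
Proof.
move=> phiL fL i v a x y /=; rewrite !slotwise_upd phiL.
exact: multilinear_comb.
Qed.

Lemma multilinear_sum (W : lmodType F) (I : Type) (r : seq I) (P : pred I)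
    (f : I -> family -> W) :
  (forall j, multilinear (f j)) ->
  multilinear (fun v => \sum_(j <- r | P j) f j v).
Proof.
move=> fL i v a x y /=; rewrite scaler_sumr -big_split.
by apply: eq_bigr => j _; apply: multilinear_comb.
Qed.

Lemma multilinear_comp (W W' : lmodType F) (f : family -> W) (h : W -> W') :
  linear h -> multilinear f -> multilinear (h \o f).
Proof. by move=> hL fL i v a x y /=; rewrite multilinear_comb // hL. Qed.

Lemma multilinear_scale (W : lmodType F) (f : family -> W) c :
  multilinear f -> multilinear (fun v => c *: f v).
Proof.
by move=> fL i v a x y /=; rewrite multilinear_comb // scalerDr !scalerA mulrC.
Qed.

Lemma multilinear_perm (W : lmodType F) (f : family -> W) (s : 'S_n) :
  multilinear f -> multilinear (fun v => f [ffun i => v (s i)]).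
Proof.
move=> fL i v a x y /=.
have E z : [ffun k => upd v i z (s k)] = upd [ffun k => v (s k)] (s^-1 i)%g z.
  apply/ffunP => k; rewrite !ffunE.
  by rewrite -(can2_eq (permK s) (permKV s)).
by rewrite !E; apply: multilinear_comb.
Qed.

Lemma hlift_tens (W : lmodType F) (G : parities -> family -> W) e v :
  (forall e', multilinear (G e')) -> homogs e v -> hlift G (tens v) = G e v.
Proof.
move=> GL ev; rewrite /hlift tlift_tens; last first.
  apply: multilinear_sum => e'.
  by apply: (multilinear_slotwise (phi := fun k => gproj V (e' k))) => // k;
     apply: gproj_linear.
rewrite (bigD1 e) //= big1 ?addr0 => [|e' ne_e].
  by congr (G e); apply/ffunP => i; rewrite ffunE ev.
have [i ne_i]: exists i, e' i != e i.
  apply/existsP; apply: contraR ne_e; rewrite negb_exists => /forallP E.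
  by apply/eqP/ffunP => i; apply/eqP; rewrite -[_ == _]negbK.
apply: (@multilinear0 _ _ _ _ _ i) => //.
by rewrite ffunE (gproj_homog _ (ev i)) (negPf ne_i).
Qed.

Lemma gen_homog : gen (fun x : V => exists b, homog V b x).
Proof.
move=> P P0 PD Ph x; rewrite -(gproj_sum V x) -[gproj V false x]scale1r.
by apply: PD; apply: Ph; eexists; apply: homog_gproj.
Qed.

Lemma hext (W : lmodType F) (g h : tpow n V -> W) : linear g -> linear h ->
  (forall e v, homogs e v -> g (tens v) = h (tens v)) -> g =1 h.
Proof.
move=> gL hL gh.
pose g' : {linear tpow n V -> W} :=
  HB.pack g (GRing.isLinear.Build F (tpow n V) W *:%R g gL).
pose h' : {linear tpow n V -> W} :=
  HB.pack h (GRing.isLinear.Build F (tpow n V) W *:%R h hL).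
apply: (tpow_ext (g := g') (h := h') gen_homog) => v /= Hv.
have [e He] := fin_all_exists Hv.
by apply: (gh [ffun i => e i]) => i; rewrite ffunE.
Qed.

Lemma hlift_comb (W : lmodType F) (G G1 G2 : parities -> family -> W) a t :
  (forall e v, G e v = a *: G1 e v + G2 e v) ->
  hlift G t = a *: hlift G1 t + hlift G2 t.
Proof.
move=> E; rewrite /hlift /tlift scaler_sumr -big_split /=.
apply: eq_bigr => s _; rewrite scalerA mulrC -scalerA -scalerDr; congr (_ *: _).
by rewrite scaler_sumr -big_split; apply: eq_bigr.
Qed.

Lemma homogs_upd e v i b x : homogs e v -> homog V b x ->
  homogs [ffun k => if k == i then b else e k] (upd v i x).
Proof. by move=> ev bx k; rewrite !ffunE; case: eqP. Qed.

Lemma homogs_perm e v (s : 'S_n) : homogs e v ->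
  homogs [ffun i => e (s i)] [ffun i => v (s i)].
Proof. by move=> ev i; rewrite !ffunE. Qed.

End HomogeneousLift.

Section SymmetricGroupAction.
Variables (F : fieldType) (n : nat) (V : superspace F).
Local Notation family := {ffun 'I_n -> V}.
Local Notation parities := {ffun 'I_n -> bool}.
Implicit Types (v : family) (e : parities) (i j k : 'I_n) (s t : 'S_n).

(* The Koszul sign of [s] on homogeneous vectors of parities [e]: one factor for
   each pair of positions that [s] inverts. *)
Definition koszul s e : F :=
  \prod_(i < n) \prod_(j < n | (i < j)%N && (s j < s i)%N) eta F (e i) (e j).

(* v_1 (x) ... (x) v_n is sent to the signed tensor with v_i in position s(i).
   This is the action generated by the signed adjacent transpositions
   ([sact_tperm], [sactM]); since (s * t) i = t (s i) for permutations,
   [sactM] is the law of a left action for composition of maps. *)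
Definition sact s : tpow n V -> tpow n V :=
  hlift (fun e v => koszul s e *: tens [ffun i => v ((s^-1)%g i)]).

HB.instance Definition _ s := GRing.Linear.on (sact s).

Lemma sact_tens s e v : homogs e v ->
  sact s (tens v) = koszul s e *: tens [ffun i => v ((s^-1)%g i)].
Proof.
move=> ev; rewrite /sact (hlift_tens (e := e)) // => e'.
exact/multilinear_scale/multilinear_perm/multilinear_tens.
Qed.

Definition inverted s i j := (i < j)%N (+) (s i < s j)%N.

Lemma invertedC s i j : inverted s i j = inverted s j i.
Proof.
rewrite /inverted; have [->//|ne_ij] := eqVneq i j.
have E (a b : 'I_n) : a != b -> (b < a)%N = ~~ (a < b)%N.
  by move=> ne; rewrite -leqNgt ltn_neqAle eq_sym (inj_eq val_inj) ne.
by rewrite (E i j) // (E (s i) (s j)) ?(inj_eq perm_inj) // addbN addNb negbK.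
Qed.

Lemma prod_pairs_perm s (h : 'I_n -> 'I_n -> F) : (forall i j, h i j = h j i) ->
  \prod_(p : 'I_n * 'I_n | (p.1 < p.2)%N) h (s p.1) (s p.2) =
  \prod_(p : 'I_n * 'I_n | (p.1 < p.2)%N) h p.1 p.2.
Proof.
move=> hC; pose so (p : 'I_n * 'I_n) := if (p.1 < p.2)%N then p else (p.2, p.1).
pose ph (r : 'S_n) (p : 'I_n * 'I_n) := so (r p.1, r p.2).
have so_lt (p : 'I_n * 'I_n) : p.1 != p.2 -> ((so p).1 < (so p).2)%N.
  rewrite /so; case: ifP => //= /negbT; rewrite -leqNgt => le ne.
  by rewrite ltn_neqAle le andbT eq_sym.
have ph_lt (r : 'S_n) (p : 'I_n * 'I_n) : (p.1 < p.2)%N -> ((ph r p).1 < (ph r p).2)%N.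
  move=> lt; apply: so_lt; rewrite /= (inj_eq perm_inj).
  by apply: contraTneq lt => ->; rewrite ltnn.
have phK (r : 'S_n) (p : 'I_n * 'I_n) : (p.1 < p.2)%N -> ph r^-1%g (ph r p) = p.
  case: p => a b /= lt; rewrite /ph {2 3}/so /=.
  case: ifP => _ /=; rewrite !permK /so /= ?lt // ltnNge (ltnW lt) //.
rewrite [RHS](reindex_onto (ph s) (ph s^-1%g)) /=; last first.
  by move=> p lt; have := phK s^-1%g p lt; rewrite invgK.
apply: eq_big => [p|p lt]; last by rewrite /ph /so /=; case: ifP => //=.
apply/idP/andP => [lt|[lt /eqP <-]]; last exact: ph_lt.
by split; [apply: ph_lt | rewrite phK].
Qed.

Lemma koszulE s e : koszul s e = \prod_(p : 'I_n * 'I_n | (p.1 < p.2)%N)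
  (if inverted s p.1 p.2 then eta F (e p.1) (e p.2) else 1).
Proof.
rewrite /koszul -big_mkcondr pair_big_dep /=; apply: eq_bigl => -[i j] /=.
case: (ltnP i j) => //= lt; rewrite /inverted lt addTb -leqNgt ltn_neqAle.
rewrite (inj_eq val_inj) (inj_eq perm_inj).
by rewrite (_ : j != i) //; apply: contraTneq lt => ->; rewrite ltnn.
Qed.

Lemma inverted_sym_eta s e i j :
  (if inverted s i j then eta F (e i) (e j) else 1) =
  (if inverted s j i then eta F (e j) (e i) else 1).
Proof. by rewrite invertedC etaC. Qed.

Lemma koszulM s t e :
  koszul (s * t)%g e = koszul s e * koszul t [ffun i => e ((s^-1)%g i)].
Proof.
rewrite !koszulE.
rewrite -(prod_pairs_perm s (inverted_sym_eta t [ffun i => e ((s^-1)%g i)])).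
rewrite -big_split; apply: eq_bigr => -[i j] /= _; rewrite !ffunE !permK.
rewrite {1}/inverted !permM.
rewrite -[(i < j)%N](addbK (s i < s j)%N) -addbA.
rewrite -!/(inverted _ _ _).
by case: inverted; case: inverted; rewrite /= ?mulr1 ?mul1r ?eta_sq.
Qed.

Lemma koszul_sq s e : koszul s e * koszul s e = 1.
Proof.
rewrite koszulE -big_split big1 //= => p _.
by case: ifP; rewrite ?eta_sq ?mulr1.
Qed.

Lemma sactM s t x : sact (s * t)%g x = sact t (sact s x).
Proof.
move: x; apply: hext => [|a x y|e v ev]; rewrite ?linearP //; first exact: linearP.
rewrite (sact_tens (s * t)%g ev) (sact_tens s ev) linearZ /=.
rewrite (sact_tens _ (homogs_perm s^-1%g ev)) scalerA -koszulM.
by congr (_ *: tens _); apply/ffunP => i; rewrite !ffunE invMg permM.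
Qed.

Lemma sact1 x : sact 1%g x = x.
Proof.
move: x; apply: hext => [|a x y|e v ev] //; first exact: linearP.
rewrite (sact_tens _ ev) koszulE big1 ?scale1r => [|p _]; last first.
  by rewrite /inverted !perm1 addbb.
by congr tens; apply/ffunP => i; rewrite ffunE invg1 perm1.
Qed.

Lemma sact_tperm i j e v : val j = i.+1 -> homogs e v ->
  sact (tperm i j) (tens v) =
    eta F (e i) (e j) *: tens [ffun k => v (tperm i j k)].
Proof.
move=> ij ev; rewrite (sact_tens _ ev) tpermV; congr (_ *: _).
rewrite /koszul (bigD1 i) //= [X in _ * X]big1 ?mulr1 => [|a ne_ai].
  rewrite (bigD1 j) /=; last by rewrite tpermL tpermR ij !ltnSn.
  rewrite big1 ?mulr1 // => b /andP[/andP[ltib lt] ne_bj].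
  move: lt; rewrite tpermL tpermD; last 2 first.
  - by apply: contraTneq ltib => ->; rewrite ltnn.
  - by rewrite eq_sym.
  by rewrite ij ltnS leqNgt ltib.
rewrite big1 // => b /andP[ltab]; rewrite ltnNge => /negP[].
case: tpermP ltab ne_ai => [-> _|-> lt _|_ ne_aj lt ne_ai]; first by rewrite eqxx.
  case: tpermP lt => [->|-> |_ _ lt]; first by rewrite ij ltnNge leqnSn.
    by rewrite ltnn.
  by apply: leq_trans (ltnW lt); rewrite ij.
case: tpermP lt => [->|->|_ _]; last exact: ltnW.
  by move=> lt; rewrite ij ltnW // ltnS ltnW.
by rewrite ij ltnS.
Qed.

End SymmetricGroupAction.

Section SymmetricPower.
Variables (F : fieldType) (n : nat) (V : superspace F).
Local Notation family := {ffun 'I_n -> V}.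
Local Notation parities := {ffun 'I_n -> bool}.
Implicit Types (v : family) (e : parities) (s : 'S_n).

Definition parity_sum e := \big[addb/false]_i e i.

Definition tproj b : tpow n V -> tpow n V :=
  hlift (fun e v => if parity_sum e == b then tens v else 0).

HB.instance Definition _ b := GRing.Linear.on (tproj b).

Lemma tproj_tens b e v : homogs e v ->
  tproj b (tens v) = if parity_sum e == b then tens v else 0.
Proof.
move=> ev; rewrite /tproj (hlift_tens (e := e)) // => e'.
case: eqP => _; first exact: multilinear_tens.
by move=> i u a x y; rewrite scaler0 addr0.
Qed.

Fact tproj_linear b : linear (tproj b).
Proof. exact: linearP. Qed.

Fact tprojK b c t : tproj b (tproj c t) = if b == c then tproj c t else 0.
Proof.
move: t; apply: hext => [a t u|a t u|e v ev]; first by rewrite !linearP.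
  by case: ifP; rewrite ?linearP ?scaler0 ?addr0.
rewrite (tproj_tens c ev) (fun_if (tproj b)) linear0 (tproj_tens b ev).
by case: b; case: c; case: parity_sum.
Qed.

Fact tproj_sum t : tproj false t + tproj true t = t.
Proof.
move: t; apply: hext => [a t u||e v ev] //.
  by rewrite !linearP scalerDr addrACA.
by rewrite !(tproj_tens _ ev); case: parity_sum; rewrite ?addr0 ?add0r.
Qed.

Definition tpow_super := Superspace (Grading tproj_linear tprojK tproj_sum).

Lemma parity_sum_perm e s : parity_sum [ffun i => e (s i)] = parity_sum e.
Proof.
rewrite [RHS](reindex_inj (@perm_inj _ s)) /=.
by apply: eq_bigr => i _; rewrite ffunE.
Qed.

Lemma tproj_sact b s t : tproj b (sact s t) = sact s (tproj b t).
Proof.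
move: t; apply: hext => [a t u|a t u|e v ev].
- by rewrite !linearP.
- by rewrite !linearP.
rewrite (sact_tens s ev) linearZ /= (tproj_tens b ev).
rewrite (tproj_tens b (homogs_perm s^-1%g ev)) parity_sum_perm.
by case: ifP => _; rewrite ?linear0 ?scaler0 ?(sact_tens s ev).
Qed.

(* the span of all t - s.t; for a fixed s these form the image of 1 - s *)
Definition vee_rel : {vspace tpow n V} :=
  (\sum_(s : 'S_n) limg (\1%VF - linfun (sact s)))%VS.

Definition vee_space := quotv vee_rel.
HB.instance Definition _ := Vector.on vee_space.

Definition vee v : vee_space := vpi vee_rel (tens v).

Lemma vee_rel_mem s t : t - sact s t \in vee_rel.
Proof.
have E : t - sact s t = (\1%VF - linfun (sact s)) t by rewrite add_lfunE opp_lfunE id_lfunE lfunE.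
rewrite /vee_rel (bigD1 s) //=; apply: (subvP (addvSl _ _)).
by rewrite E memv_img ?memvf.
Qed.

Lemma vpi_sact s t : vpi vee_rel (sact s t) = vpi vee_rel t.
Proof. by apply/esym/eqP; rewrite vpi_eq vee_rel_mem. Qed.

Lemma vee_rel_lift (W : lmodType F) (g : tpow n V -> W) : linear g ->
  (forall s t, g (sact s t) = g t) -> forall u, g (vrepr (vpi vee_rel u)) = g u.
Proof.
move=> gL gs u; pose g' : {linear tpow n V -> W} :=
  HB.pack g (GRing.isLinear.Build F (tpow n V) W *:%R g gL).
apply/eqP; rewrite -subr_eq0 -(linearB g').
have /memv_sumP[w Hw ->] := vrepr_sub vee_rel u.
rewrite linear_sum big1 // => s _.
have /memv_imgP[t _ ->] := Hw s isT.
by rewrite add_lfunE opp_lfunE id_lfunE lfunE linearB /= gs subrr.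
Qed.

Definition vproj b (q : vee_space) : vee_space := vpi vee_rel (tproj b (vrepr q)).

Lemma vproj_vpi b t : vproj b (vpi vee_rel t) = vpi vee_rel (tproj b t).
Proof.
apply: (vee_rel_lift (g := fun t => vpi vee_rel (tproj b t))) => [a x y|s x].
  by rewrite !linearP.
by rewrite tproj_sact vpi_sact.
Qed.

Fact vproj_linear b : linear (vproj b).
Proof.
by move=> a x y; rewrite -[x]vreprK -[y]vreprK -linearP !vproj_vpi !linearP.
Qed.
Fact vprojK b c q : vproj b (vproj c q) = if b == c then vproj c q else 0.
Proof.
by rewrite -[q]vreprK !vproj_vpi tprojK; case: ifP => // _; rewrite linear0.
Qed.
Fact vproj_sum q : vproj false q + vproj true q = q.
Proof. by rewrite -[q]vreprK !vproj_vpi -linearD /= tproj_sum. Qed.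

Definition vee_super := Superspace (Grading vproj_linear vprojK vproj_sum).

End SymmetricPower.

Section Dual.
Variables (F : fieldType) (V : superspace F).

(* (V^* )_b is the space of functionals that vanish on the other part of V
   ([homog_dual]) *)
Definition dproj b (f : 'Hom(V, F^o)) : 'Hom(V, F^o) :=
  linfun (fun v => f (gproj V b v)).

Lemma dprojE b f v : dproj b f v = f (gproj V b v).
Proof.
pose g : {linear V -> F^o} := f \o gproj V b.
by rewrite /dproj -[RHS]/(g v) -(lfunE g).
Qed.

Fact dproj_linear b : linear (dproj b).
Proof. by move=> a f g; apply/lfunP => v; rewrite !(add_lfunE, scale_lfunE, dprojE). Qed.
Fact dprojK b c f : dproj b (dproj c f) = if b == c then dproj c f else 0.
Proof.
apply/lfunP => v; rewrite !dprojE gprojK eq_sym.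
by case: eqP => [->|_]; rewrite ?dprojE // linear0 zero_lfunE.
Qed.
Fact dproj_sum f : dproj false f + dproj true f = f.
Proof. by apply/lfunP => v; rewrite add_lfunE !dprojE -linearD gproj_sum. Qed.

Definition dual_super := Superspace (Grading dproj_linear dprojK dproj_sum).

Lemma homog_dual b (f : dual_super) :
  homog dual_super b f <-> (forall c v, homog V c v -> c != b -> f v = 0).
Proof.
split=> [<- c v <- ne|E].
  by rewrite /= dprojE gprojK eq_sym (negPf ne) linear0.
apply/lfunP => v; rewrite /= dprojE -[in RHS](gproj_sum V v) linearD /=.
case: b E => E.
  by rewrite (E false _ (homog_gproj _ _ _)) ?add0r.
by rewrite (E true _ (homog_gproj _ _ _)) ?addr0.
Qed.

End Dual.

Section Form.
Variables (F : fieldType) (n : nat) (V : superspace F).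
Local Notation V' := (dual_super V).

(* The value on f_1 (x) ... (x) f_n and v_1 (x) ... (x) v_n homogeneous of
   parities e' and e; see [tpair_tens]. *)
Definition tpair (f : tpow n V') (t : tpow n V) : F^o :=
  hlift (fun e' (fs : {ffun 'I_n -> V'}) =>
    hlift (fun e (vs : {ffun 'I_n -> V}) =>
      (\prod_(i < n) \prod_(j < n | (j < i)%N) eta F (e' i) (e j)) *
        (\prod_i fs i (vs i)) : F^o) t) f.

Definition tform (f : tpow n V') (t : tpow n V) : F^o :=
  \sum_(s : 'S_n) tpair f (sact s t).

(* the form induced by [tform] on the quotients, see [vformE] *)
Definition vform (p : vee_super n V') (q : vee_super n V) : F^o :=
  tform (vrepr p) (vrepr q).

Lemma multilinear_prodr (fs : {ffun 'I_n -> V'}) c :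
  multilinear (fun vs : {ffun 'I_n -> V} => c * \prod_i fs i (vs i) : F^o).
Proof.
move=> i v a x y /=; rewrite !(prod_upd (fun k => fs k)) linearP mulrDl mulrDr.
by congr (_ + _); rewrite /GRing.scale /= -!mulrA mulrCA.
Qed.

Lemma multilinear_prodl (vs : {ffun 'I_n -> V}) c :
  multilinear (fun fs : {ffun 'I_n -> V'} => c * \prod_i fs i (vs i) : F^o).
Proof.
move=> i v a x y /=; rewrite !(prod_upd (fun k (f : V') => f (vs k))).
rewrite add_lfunE scale_lfunE mulrDl mulrDr.
by congr (_ + _); rewrite /GRing.scale /= -!mulrA mulrCA.
Qed.

Lemma tpair_linearl t : linear (tpair^~ t).
Proof. by move=> a f g; rewrite /tpair linearP. Qed.

Lemma tpair_linearr f : linear (tpair f).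
Proof.
move=> a t u; rewrite /tpair; apply: hlift_comb => e fs.
by rewrite linearP.
Qed.

Lemma tpair_tens e' fs e vs : homogs e' fs -> homogs e vs ->
  tpair (tens fs) (tens vs) =
    (\prod_(i < n) \prod_(j < n | (j < i)%N) eta F (e' i) (e j)) *
      (\prod_i fs i (vs i)).
Proof.
move=> Hf Hv; rewrite /tpair (hlift_tens (e := e')) //.
  rewrite (hlift_tens (e := e)) // => e1; exact: multilinear_prodr.
move=> e1 i fs1 a x y /=; apply: hlift_comb => e2 vs1.
exact: multilinear_prodl.
Qed.

Lemma tpair_sact s f t : tpair (sact s f) (sact s t) = tpair f t.
Proof.
move: f; apply: hext => [a f g|a f g|e' fs Hf].
- by rewrite linearP tpair_linearl.
- by rewrite tpair_linearl.
move: t; apply: hext => [a t u|a t u|e vs Hv].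
- by rewrite linearP tpair_linearr.
- by rewrite tpair_linearr.
rewrite (sact_tens s Hf) (sact_tens s Hv).
rewrite (linear_scale _ _ (tpair_linearl _)) (linear_scale _ _ (tpair_linearr _)).
rewrite (tpair_tens (homogs_perm s^-1%g Hf) (homogs_perm s^-1%g Hv)).
rewrite (tpair_tens Hf Hv).
have -> : \prod_i [ffun i0 => fs (s^-1%g i0)] i ([ffun i0 => vs (s^-1%g i0)] i)
        = \prod_i fs i (vs i).
  rewrite [RHS](reindex_inj (@perm_inj _ s^-1%g)) /=.
  by apply: eq_bigr => i _; rewrite !ffunE.
have [i ne_i|eq_e] := pickP (fun i => e' i != e i).
  rewrite [\prod_i fs i (vs i)](bigD1 i) //=.
  move/homog_dual: (Hf i) => /(_ _ _ (Hv i)) ->; last by rewrite eq_sym.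
  by rewrite !(mul0r, mulr0) /GRing.scale /= !mulr0.
have {}eq_e : e' = e by apply/ffunP => i; apply/eqP; rewrite -[_ == _]negbK eq_e.
rewrite {}eq_e /GRing.scale /= !mulrA koszul_sq mul1r; congr (_ * _).
have E (d : {ffun 'I_n -> bool}) :
    \prod_(i < n) \prod_(j < n | (j < i)%N) eta F (d i) (d j) =
    \prod_(p : 'I_n * 'I_n | (p.1 < p.2)%N) eta F (d p.1) (d p.2).
  rewrite (exchange_big_dep predT) //= pair_big_dep /=.
  by apply: eq_bigr => p _; rewrite etaC.
rewrite !E; set e1 := [ffun i => e _].
have := prod_pairs_perm s (h := fun i j => eta F (e1 i) (e1 j)) (fun i j => etaC _ _ _).
move=> /= <-; apply: eq_bigr => p _; by rewrite !ffunE !permK.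
Qed.

Lemma tform_linearl t : linear (tform^~ t).
Proof.
move=> a f g; rewrite /tform scaler_sumr -big_split.
by apply: eq_bigr => s _; rewrite tpair_linearl.
Qed.

Lemma tform_linearr f : linear (tform f).
Proof.
move=> a t u; rewrite /tform scaler_sumr -big_split.
by apply: eq_bigr => s _; rewrite linearP tpair_linearr.
Qed.

Lemma tform_sactr s f t : tform f (sact s t) = tform f t.
Proof.
rewrite /tform [RHS](reindex_inj (mulgI s)) /=.
by apply: eq_bigr => r _; rewrite sactM.
Qed.

Lemma tform_sactl s f t : tform (sact s f) t = tform f t.
Proof.
rewrite /tform [LHS](reindex_inj (mulIg s)) /=.
by apply: eq_bigr => r _; rewrite sactM tpair_sact.
Qed.

Lemma vformE f t : vform (vpi _ f) (vpi _ t) = tform f t.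
Proof.
rewrite /vform (vee_rel_lift (tform_linearr _)); last by move=> s u; exact: tform_sactr.
apply: (vee_rel_lift (tform_linearl _)) => s g; exact: tform_sactl.
Qed.

End Form.

Section LieAction.
Variables (F : fieldType) (L : lieSuperalgebra F) (M : supermodule L) (n : nat).
Local Notation family := {ffun 'I_n -> M}.
Local Notation parities := {ffun 'I_n -> bool}.
Implicit Types (v : family) (e : parities) (i j k : 'I_n) (s : 'S_n).
Implicit Types (x y : L) (b c : bool).

Lemma sm_act_linearl (w : M) : linear ((@sm_act F L M)^~ w).
Proof. exact: (sm_act_bilinear M).1 w. Qed.
Lemma sm_act_linearr x : linear (@sm_act F L M x).
Proof. exact: (sm_act_bilinear M).2. Qed.

Definition tact_term x b i e v : tpow n M :=
  (\prod_(k < n | (k < i)%N) eta F b (e k)) *: tens (upd v i (sm_act x (v i))).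

(* x.(v_1 (x) ... (x) v_n) for homogeneous v_i, the sum over [b] running over the
   homogeneous components of x *)
Definition tact x (t : tpow n M) : tpow n M :=
  \sum_(b : bool)
    hlift (fun e v => \sum_(i < n) tact_term (gproj L b x) b i e v) t.

Lemma multilinear_term x b i e : multilinear (tact_term x b i e).
Proof.
apply: multilinear_scale.
pose phi k := if k == i then @sm_act F L M x else id.
have phiL k : linear (phi k).
  by rewrite /phi; case: eqP => // _; apply: sm_act_linearr.
have E v : tens [ffun k => phi k (v k)] = tens (upd v i (sm_act x (v i))).
  by congr tens; apply/ffunP => k; rewrite !ffunE /phi; case: eqP => // ->.
move=> j v a u w; rewrite -!E.
exact: (multilinear_slotwise phiL (@multilinear_tens _ _ _)).
Qed.

Lemma tact_linearr x : linear (tact x).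
Proof.
move=> a t u; rewrite /tact scaler_sumr -big_split.
by apply: eq_bigr => b _; rewrite linearP.
Qed.
HB.instance Definition _ x := GRing.isLinear.Build F (tpow n M) (tpow n M) _
  (tact x) (tact_linearr x).

Lemma tact_linearl t : linear (tact^~ t).
Proof.
move=> a x y; rewrite /tact scaler_sumr -big_split.
apply: eq_bigr => b _; apply: hlift_comb => e v.
rewrite scaler_sumr -big_split; apply: eq_bigr => i _ /=.
rewrite /tact_term linearP sm_act_linearl multilinear_tens.
by rewrite scalerDr !scalerA mulrC.
Qed.

Lemma tact_tens b x e v : homog L b x -> homogs e v ->
  tact x (tens v) = \sum_(i < n) tact_term x b i e v.
Proof.
move=> bx ev; rewrite /tact (bigD1 b) //= [X in _ + X]big1 ?addr0 => [|c ne_cb].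
  rewrite (hlift_tens (e := e)) // => [|e'].
    by apply: eq_bigr => i _; rewrite bx.
  by apply: multilinear_sum => i; apply: multilinear_term.
rewrite (gproj_homog _ bx) (negPf ne_cb) (hlift_tens (e := e)) // => [|e'].
  rewrite big1 // => i _; rewrite /tact_term.
  have -> : sm_act 0 (v i) = 0.
    by have := linear_scale 0 0 (sm_act_linearl (v i)); rewrite !scale0r.
  rewrite (multilinear0 (i := i) (@multilinear_tens F n M)) ?scaler0 //.
  by rewrite ffunE eqxx.
by apply: multilinear_sum => i; apply: multilinear_term.
Qed.

Definition updp e i b : parities := [ffun k => if k == i then b else e k].

Lemma homogs_act b x e v i : homog L b x -> homogs e v ->
  homogs (updp e i (b (+) e i)) (upd v i (sm_act x (v i))).
Proof. by move=> bx ev; apply: homogs_upd => //; apply: sm_act_homog. Qed.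

Lemma tact_homog (g h : L -> tpow n M) : linear g -> linear h ->
  (forall b x, homog L b x -> g x = h x) -> g =1 h.
Proof.
move=> gL hL gh x; rewrite -(gproj_sum L x) -[gproj L false x]scale1r gL hL.
by rewrite !(gh _ _ (homog_gproj _ _ _)).
Qed.

Lemma koszul_upd s e b i :
  koszul F s (updp e i (b (+) e i)) =
    koszul F s e * \prod_(k | inverted s k i && (k != i)) eta F b (e k).
Proof.
rewrite !koszulE.
pose X p q := if inverted s p q && (p == i) && (q != i) then eta F b (e q) else 1.
transitivity (koszul F s e *
  \prod_(p : 'I_n * 'I_n | (p.1 < p.2)%N) (X p.1 p.2 * X p.2 p.1)).
  rewrite koszulE -big_split; apply: eq_bigr => -[p q] /= ltpq; rewrite /X !ffunE.
  rewrite (invertedC s q p); case: inverted; rewrite /= ?mulr1 //.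
  have [Ep|ne_p] := eqVneq p i; have [Eq|ne_q] := eqVneq q i; rewrite ?mulr1 ?mul1r //=.
  - by rewrite Ep Eq ltnn in ltpq.
  - by rewrite Ep eta_addl mulrC.
  - by rewrite Eq eta_addr mulrC [eta F _ b]etaC.
rewrite koszulE; congr (_ * _); rewrite big_split /=.
have E (Y : 'I_n -> 'I_n -> F) :
    \prod_(p : 'I_n * 'I_n | (p.1 < p.2)%N) Y p.1 p.2 =
    \prod_(p < n) \prod_(q < n | (p < q)%N) Y p q.
  by rewrite pair_big_dep.
rewrite (E X) (E (fun p q => X q p)).
rewrite [X in _ * X](exchange_big_dep predT) //= -big_split /=.
rewrite (bigD1 i) //= [X in _ * X]big1 ?mulr1 => [|p /negPf ne_p]; last first.
  by rewrite !big1 ?mulr1 // => q _; rewrite /X ne_p andbF.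
rewrite /X eqxx [RHS]big_mkcond [X in X * _]big_mkcond [X in _ * X]big_mkcond.
rewrite -big_split; apply: eq_bigr => k _ /=.
rewrite andbT invertedC; case: (ltngtP i k) => [lt|lt|/val_inj ->];
  by rewrite ?mulr1 ?mul1r ?eqxx ?andbF.
Qed.

Lemma tact_sact x s t : tact x (sact s t) = sact s (tact x t).
Proof.
apply: (tact_homog (g := tact^~ (sact s t)) (h := fun x => sact s (tact x t)));
  first exact: tact_linearl.
  by move=> a y z; rewrite tact_linearl linearP.
move=> {}b {}x bx; move: t; apply: hext => [a t u|a t u|e v ev].
- by rewrite !linearP.
- by rewrite !linearP.
rewrite (sact_tens s ev) linearZ /= (tact_tens bx (homogs_perm s^-1%g ev)).
rewrite (tact_tens bx ev).
rewrite scaler_sumr linear_sum (reindex_inj (@perm_inj _ s)) /=.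
apply: eq_bigr => i _; rewrite /tact_term [RHS]linearZ /= (sact_tens s (homogs_act i bx ev)).
rewrite !ffunE permK !scalerA; congr (_ *: tens _); last first.
  apply/ffunP => k; rewrite !ffunE -(can2_eq (permKV s) (permK s)).
  by case: eqP.
rewrite koszul_upd [RHS]mulrCA; congr (_ * _).
rewrite [LHS](reindex_inj (@perm_inj _ s)) /=.
under eq_bigr => k _ do rewrite ffunE permK.
rewrite [LHS]big_mkcond [X in X * _]big_mkcond [X in _ * X]big_mkcond -big_split /=.
apply: eq_bigr => k _; rewrite /inverted.
have [->|_] := eqVneq k i; first by rewrite !ltnn andbF mulr1.
by case: (k < i)%N; case: (s k < s i)%N => /=; rewrite ?mulr1 ?mul1r ?eta_sq.
Qed.

Lemma parity_sum_upd e i b : parity_sum (updp e i (b (+) e i)) = b (+) parity_sum e.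
Proof.
rewrite /parity_sum (bigD1 i) //= [in RHS](bigD1 i) //= ffunE eqxx addbA.
by congr (_ (+) _); apply: eq_bigr => k /negPf ne; rewrite ffunE ne.
Qed.

Lemma tact_tproj b c x t : homog L b x ->
  tproj (b (+) c) (tact x t) = tact x (tproj c t).
Proof.
move=> bx; move: t; apply: hext => [a t u|a t u|e v ev].
- by rewrite !linearP.
- by rewrite !linearP.
rewrite (tproj_tens c ev) (fun_if (tact x)) linear0 (tact_tens bx ev) linear_sum.
case: eqP => [<-|ne_c].
  apply: eq_bigr => i _; rewrite linearZ /=.
  by rewrite (tproj_tens _ (homogs_act i bx ev)) parity_sum_upd eqxx.
rewrite big1 // => i _; rewrite linearZ /=.
rewrite (tproj_tens _ (homogs_act i bx ev)) parity_sum_upd.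
by rewrite (inj_eq (@addbI b)) (negPf (introN eqP ne_c)) scaler0.
Qed.

Lemma sign_upd b e i c j :
  \prod_(k < n | (k < j)%N) eta F b (updp e i (c (+) e i) k) =
  (if (i < j)%N then eta F b c else 1) * \prod_(k < n | (k < j)%N) eta F b (e k).
Proof.
case: ifP => ij.
  rewrite [LHS](bigD1 i) //= [in RHS](bigD1 i) //= ffunE eqxx eta_addr -!mulrA.
  congr (_ * (_ * _)); apply: eq_bigr => k /andP[_ /negPf ne].
  by rewrite ffunE ne.
rewrite mul1r; apply: eq_bigr => k kj; rewrite ffunE.
by case: eqP => // ki; rewrite -ki kj in ij.
Qed.

Lemma tact_tact b c x y e v : homog L b x -> homog L c y -> homogs e v ->
  tact x (tact y (tens v)) = \sum_(i < n) \sum_(j < n)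
    ((if (i < j)%N then eta F b c else 1) *
      ((\prod_(k < n | (k < j)%N) eta F b (e k)) *
       (\prod_(k < n | (k < i)%N) eta F c (e k)))) *:
    tens (upd (upd v i (sm_act y (v i))) j
           (sm_act x (upd v i (sm_act y (v i)) j))).
Proof.
move=> bx cy ev; rewrite (tact_tens cy ev) linear_sum; apply: eq_bigr => i _.
rewrite linearZ /= (tact_tens bx (homogs_act i cy ev)) scaler_sumr.
apply: eq_bigr => j _; rewrite /tact_term scalerA sign_upd.
by congr (_ *: _); rewrite mulrC mulrA.
Qed.

Lemma tact_bracket b c x y t : homog L b x -> homog L c y ->
  tact (bracket x y) t = tact x (tact y t) - eta F b c *: tact y (tact x t).
Proof.
move=> bx cy; move: t; apply: hext => [a t u|a t u|e v ev].
- by rewrite linearP.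
- by rewrite !linearP scalerDr addrACA.
rewrite (tact_tens (bracket_homog bx cy) ev).
rewrite (tact_tact bx cy ev) (tact_tact cy bx ev).
rewrite [X in _ - _ *: X]exchange_big /= scaler_sumr -sumrB; apply: eq_bigr => i _.
rewrite scaler_sumr -sumrB (bigD1 i) //= [X in _ + X]big1 ?addr0 => [|j ne_ji].
  rewrite !ltnn !mul1r /tact_term.
  have E z w : upd (upd v i z) i w = upd v i w.
    by apply/ffunP => k; rewrite !ffunE; case: eqP.
  rewrite !E !ffunE eqxx (sm_act_bracket (v i) bx cy).
  have -> : \prod_(k < n | (k < i)%N) eta F (b (+) c) (e k) =
      \prod_(k < n | (k < i)%N) eta F b (e k) * \prod_(k < n | (k < i)%N) eta F c (e k).
    by rewrite -big_split; apply: eq_bigr => k _; rewrite eta_addl.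
  rewrite [sm_act x _ - _]addrC -scaleNr multilinear_tens scalerDr [LHS]addrC.
  rewrite !scalerA mulrN scaleNr; congr (_ *: _ - _ *: _).
  by rewrite mulrC; congr (_ * _); apply: mulrC.
apply/eqP; rewrite subr_eq0 scalerA !ffunE (negPf ne_ji) [i == j]eq_sym (negPf ne_ji).
apply/eqP; congr (_ *: tens _); last first.
  apply/ffunP => k; rewrite !ffunE; case: eqP => [->|//].
  by rewrite (negPf ne_ji).
rewrite [RHS]mulrA; congr (_ * _); last exact: mulrC.
case: (ltngtP i j) => [lt|lt|/val_inj eq_ij]; last by rewrite eq_ij eqxx in ne_ji.
  by rewrite mulr1.
by rewrite [eta F c b]etaC eta_sq.
Qed.

(* the action on classes: [vact_vpi], [vact_vee] *)
Definition vact x (q : vee_super n M) : vee_super n M :=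
  vpi (vee_rel n M) (tact x (vrepr q)).

Lemma vact_vpi x t : vact x (vpi _ t) = vpi _ (tact x t).
Proof.
apply: (vee_rel_lift (g := fun t => vpi (vee_rel n M) (tact x t))) => [a u w|s u].
  by rewrite !linearP.
by rewrite tact_sact vpi_sact.
Qed.

Lemma vact_vee b x e v : homog L b x -> homogs e v ->
  vact x (vee v) = \sum_(i < n)
    (\prod_(k < n | (k < i)%N) eta F b (e k)) *: vee (upd v i (sm_act x (v i))).
Proof.
move=> bx ev; rewrite /vee vact_vpi (tact_tens bx ev) linear_sum.
by apply: eq_bigr => i _; rewrite linearZ.
Qed.

Fact vact_bilinear : is_bilinear vact.
Proof.
split=> [q a x y | x a q r].
  by rewrite -[q]vreprK !vact_vpi tact_linearl linearP.
by rewrite -[q]vreprK -[r]vreprK -linearP !vact_vpi !linearP.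
Qed.

Fact vact_homog b c x q : homog L b x -> homog (vee_super n M) c q ->
  homog (vee_super n M) (b (+) c) (vact x q).
Proof.
move=> bx <-; rewrite -[q]vreprK /homog /= vproj_vpi vact_vpi vproj_vpi.
by rewrite -(tact_tproj _ _ bx) tprojK eqxx.
Qed.

Fact vact_bracket b c x y q : homog L b x -> homog L c y ->
  vact (bracket x y) q = vact x (vact y q) - eta F b c *: vact y (vact x q).
Proof.
by move=> bx cy; rewrite -[q]vreprK !vact_vpi (tact_bracket _ bx cy) linearB linearZ.
Qed.

Definition vee_module : supermodule L :=
  Supermodule vact_bilinear vact_homog vact_bracket.

(* <x.f, w> = - eta_{x,f} <f, x.w>, summed over the homogeneous components of
   x and f *)
Definition dact x (f : dual_super M) : dual_super M :=
  linfun (fun w => \sum_(b : bool) \sum_(c : bool)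
    - (eta F b c * gproj (dual_super M) c f (sm_act (gproj L b x) w)) : F^o).

Lemma dactE x f w : dact x f w = \sum_(b : bool) \sum_(c : bool)
    - (eta F b c * gproj (dual_super M) c f (sm_act (gproj L b x) w)).
Proof.
pose h (w : M) : F^o := \sum_(b : bool) \sum_(c : bool)
    - (eta F b c * gproj (dual_super M) c f (sm_act (gproj L b x) w)).
have hL : linear h.
  move=> a u z; rewrite /h scaler_sumr -big_split; apply: eq_bigr => b _ /=.
  rewrite scaler_sumr -big_split; apply: eq_bigr => c _ /=.
  rewrite sm_act_linearr linearP mulrDr opprD; congr (_ + _).
  by rewrite /GRing.scale /= mulrCA -mulrN.
pose h' : {linear M -> F^o} :=
  HB.pack h (GRing.isLinear.Build F M F^o *:%R h hL).
by rewrite /dact -[RHS]/(h' w) -(lfunE h').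
Qed.

Lemma dact_homogE b c x f w : homog L b x -> homog (dual_super M) c f ->
  dact x f w = - (eta F b c * f (sm_act x w)).
Proof.
move=> bx cf; rewrite dactE (bigD1 b) //= [X in _ + X]big1 ?addr0 => [|b' ne_b].
  rewrite (bigD1 c) //= [X in _ + X]big1 ?addr0 => [|c' ne_c].
    by rewrite bx [dproj c f]cf.
  have := gproj_homog c' cf; rewrite (negPf ne_c) /= => ->.
  by rewrite zero_lfunE mulr0 oppr0.
rewrite big1 // => c' _; rewrite (gproj_homog _ bx) (negPf ne_b).
have -> : sm_act 0 w = 0.
  by have := linear_scale 0 0 (sm_act_linearl w); rewrite !scale0r.
by rewrite linear0 mulr0 oppr0.
Qed.

Fact dact_bilinear : is_bilinear dact.
Proof.
split=> [f a x y | x a f g]; apply/lfunP => w;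
  rewrite add_lfunE scale_lfunE !dactE scaler_sumr -big_split;
  apply: eq_bigr => b _; rewrite /= scaler_sumr -big_split;
  apply: eq_bigr => c _ /=.
  rewrite linearP sm_act_linearl linearP mulrDr opprD; congr (_ + _).
  by rewrite /GRing.scale /= mulrCA -mulrN.
rewrite dproj_linear add_lfunE scale_lfunE mulrDr opprD; congr (_ + _).
by rewrite /GRing.scale /= mulrCA -mulrN.
Qed.

Fact dact_homog b c x f : homog L b x -> homog (dual_super M) c f ->
  homog (dual_super M) (b (+) c) (dact x f).
Proof.
move=> bx cf; apply/homog_dual => d w dw ne_d.
rewrite (dact_homogE _ bx cf).
move/homog_dual: (cf) => /(_ _ _ (sm_act_homog bx dw)) ->; first by rewrite mulr0 oppr0.
by apply: contra ne_d => /eqP <-; rewrite addKb.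
Qed.

Fact dact_bracket b c x y f : homog L b x -> homog L c y ->
  dact (bracket x y) f = dact x (dact y f) - eta F b c *: dact y (dact x f).
Proof.
move=> bx cy.
have key d g : homog (dual_super M) d g ->
    dact (bracket x y) g = dact x (dact y g) - eta F b c *: dact y (dact x g).
  move=> dg; apply/lfunP => w; rewrite add_lfunE opp_lfunE scale_lfunE.
  rewrite (dact_homogE _ (bracket_homog bx cy) dg).
  rewrite (dact_homogE _ bx (dact_homog cy dg)) (dact_homogE _ cy dg).
  rewrite (dact_homogE _ cy (dact_homog bx dg)) (dact_homogE _ bx dg).
  rewrite (sm_act_bracket w bx cy) linearB linearZ /= !mulrN !opprK.
  rewrite /GRing.scale /= !eta_addr eta_addl [eta F c b]etaC mulrBr opprB addrC.
  rewrite addrC !mulrA eta_sq mul1r; congr (_ * _ - _ * _).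
    by rewrite mulrC !mulrA.
  exact: mulrC.
rewrite -(gproj_sum (dual_super M) f) -[gproj _ false f]scale1r.
rewrite !dact_bilinear.2 !(key _ _ (homog_gproj _ _ _)).
by rewrite !scale1r scalerDr opprD addrACA.
Qed.

Definition dual_module : supermodule L :=
  Supermodule dact_bilinear dact_homog dact_bracket.

End LieAction.

Lemma spart_addv (F : fieldType) (V : superspace F) :
  (spart V false + spart V true = fullv)%VS.
Proof.
apply/vspaceP => v; rewrite memvf -(gproj_sum V v) memv_add //;
  by apply/homog_spart/homog_gproj.
Qed.

Lemma spart_capv (F : fieldType) (V : superspace F) :
  (spart V false :&: spart V true = 0)%VS.
Proof.
apply/eqP; rewrite -subv0; apply/subvP => v; rewrite memv_cap.
case/andP => /homog_spart v0 /homog_spart v1.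
by rewrite memv0 -v1 (gproj_homog _ v0).
Qed.

Lemma vform_bilinear (F : fieldType) (n : nat) (V : superspace F) :
  is_bilinear (@vform F n V : _ -> _ -> F^o).
Proof.
split=> [q a p p' | p a q q'].
  by rewrite -[q]vreprK -[p]vreprK -[p']vreprK -linearP !vformE tform_linearl.
by rewrite -[p]vreprK -[q]vreprK -[q']vreprK -linearP !vformE tform_linearr.
Qed.

Section Pairings.
Variables (F : fieldType) (L : lieSuperalgebra F).
Implicit Types P N : supermodule L.

Definition supermodule_pairing P N (G : P -> N -> F) :=
  is_bilinear (G : P -> N -> F^o) /\
  forall b c x f v, homog L b x -> homog P c f ->
    G (sm_act x f) v = - (eta F b c * G f (sm_act x v)).

Definition nondegenerate_pairing P N (G : P -> N -> F) :=
  (forall f, (forall v, G f v = 0) -> f = 0) /\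
  (forall v, (forall f, G f v = 0) -> v = 0).

Definition dual_pairing P N (G : P -> N -> F) :=
  supermodule_pairing G /\ nondegenerate_pairing G.

Definition supermodule_iso P N (phi : P -> N) :=
  [/\ linear phi, bijective phi,
      forall b f, homog P b f -> homog N b (phi f)
    & forall x f, phi (sm_act x f) = sm_act x (phi f)].

End Pairings.

Definition vee_form (F : fieldType) (L : lieSuperalgebra F) (M : supermodule L)
    (n : nat) :
  vee_module (dual_module M) n -> vee_module M n -> F := @vform F n M.

Definition vee_form_map (F : fieldType) (L : lieSuperalgebra F)
    (M : supermodule L) (n : nat) (f : vee_module (dual_module M) n) :
  dual_module (vee_module M n) :=
  linfun (vee_form f : vee_module M n -> F^o).

Lemma vee_form_mapE (F : fieldType) (L : lieSuperalgebra F)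
    (M : supermodule L) (n : nat) (f : vee_module (dual_module M) n) q :
  vee_form_map f q = vee_form f q.
Proof.
pose h : {linear vee_module M n -> F^o} := HB.pack (vee_form f : _ -> F^o)
  (GRing.isLinear.Build F (vee_module M n) F^o *:%R _ ((vform_bilinear n M).2 f)).
by rewrite /vee_form_map -[RHS]/(h q) -(lfunE h).
Qed.

Section Indices.
Variables d0 d1 n : nat.
Implicit Types I : n.-tuple 'I_(d0 + d1).

(* Entries are numbered from 0: the even basis vectors have indices i < d0. *)
Definition vee_index I : bool :=
  let s := map val I in
  [exists k : 'I_n.+1,
    [&& (n - k <= minn d1 n)%N,
        all (fun i => i < d0)%N (take k s), sorted leq (take k s),
        all (fun i => d0 <= i)%N (drop k s) & sorted ltn (drop k s)]].

Definition omega (F : fieldType) (k : nat) : F := (-1) ^+ (k * k.-1)./2.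

(* In an index tuple, n - k is the number of entries >= d0. *)
Definition kappa (F : fieldType) I : F :=
  omega F (count (fun i : 'I_(d0 + d1) => d0 <= i)%N I) *
    (\prod_(i <- undup I) (count_mem i I)`!)%N%:R.

End Indices.

Definition vee_family (F : fieldType) (V : superspace F) (d n : nat)
    (u : d.-tuple V) (I : n.-tuple 'I_d) : vee_super n V :=
  vee [ffun a => tnth u (tnth I a)].

(* Main.v *)
Require Import Defs.
From mathcomp Require Import all_boot all_order all_algebra.
From mathcomp Require Import all_fingroup ring.
Set Implicit Arguments.
Unset Strict Implicit.
Unset Printing Implicit Defensive.
Import GRing.Theory.
Local Open Scope ring_scope.

(* Up to sign a product of basis vectors can be sorted, and since the
   characteristic is not 2 it vanishes as soon as an odd vector is repeated; so
   the families indexed by the index tuples span both symmetric powers. Their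
   Gram matrix for the induced form is diagonal: a permutation contributes to the
   (I, J) entry only if it carries one sorted word to the other, which forces
   I = J, and the permutations fixing the word I permute equal even entries, all
   with the same sign omega. The diagonal entries kappa_I are nonzero by the
   assumption on the characteristic, hence both families are dual bases up to
   scaling, and the form is nondegenerate. *)

(** * Index tuples *)

Section LevelPermutations.
Variables (T : finType) (K : eqType) (g : T -> K).
Implicit Types (s t : {perm T}) (r : seq K).

(** The list [r] serves an induction that peels off one level at a time; once [r] contains all
    values of [g], this is the whole stabilizer of [g]. *)
Definition level_perms r : {set {perm T}} :=
  [set s | perm_on [set x | g x \in r] s & [forall x, g (s x) == g x]].

Lemma mem_level_perms r s : reflect
  ((forall x, g x \notin r -> s x = x) /\ (forall x, g (s x) = g x))
  (s \in level_perms r).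
Proof.
rewrite inE; apply: (iffP andP) => [[on_s /forallP gs]|[on_s gs]].
  by split=> x; [move=> rx; apply: (out_perm on_s); rewrite inE | apply/eqP].
split; last by apply/forallP => x; rewrite gs.
apply/subsetP => x; rewrite !inE; apply: contraNT => /on_s ->; exact: eqxx.
Qed.

(** Each element factors uniquely as a permutation of the fibre over [k] times one that fixes this
    fibre pointwise, so multiplication is a bijection from [setX (Sym B) (level_perms r)]. *)
Lemma card_level_perms_cons k r : k \notin r ->
  #|level_perms (k :: r)| = (#|[set x | g x == k]|`! * #|level_perms r|)%N.
Proof.
move=> rk; set B := [set x | g x == k].
rewrite -card_Sym -cardsX.
have SymP s : s \in Sym B -> forall x, g x != k -> s x = x.
  by rewrite inE => on_s x kx; apply: (out_perm on_s); rewrite inE.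
have gSym s : s \in Sym B -> forall x, g (s x) = g x.
  move=> Bs x; have [kx|/(SymP _ Bs) -> //] := eqVneq (g x) k.
  have on_s : perm_on B s by move: Bs; rewrite inE.
  by have := perm_closed x on_s; rewrite !inE kx eqxx => /eqP.
have rfix t : t \in level_perms r -> forall x, g x == k -> t x = x.
  by move=> /mem_level_perms[on_t _] x /eqP kx; apply: on_t; rewrite kx.
have inj : {in setX (Sym B) (level_perms r) &,
    injective (fun st : {perm T} * {perm T} => (st.1 * st.2)%g)}.
  case=> s t [s' t'] /setXP[/= Bs rt] /setXP[/= Bs' rt'] E.
  have Es : s = s'.
    apply/permP => x; have [kx|kx] := boolP (g x == k); last by rewrite !SymP.
    move/permP/(_ x): E; rewrite !permM (rfix t) ?gSym // (rfix t') ?gSym //.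
  by congr (_, _) => //; move: E; rewrite Es => /mulgI.
rewrite -(card_in_imset inj); congr #|pred_of_set _|; apply/setP => s.
apply/idP/imsetP => [/mem_level_perms[on_s gs]|[[s1 t] /setXP[/= Bs rt] ->]].
  have Bx x : (s x \in B) = (x \in B) by rewrite !inE gs.
  have nBs : s \in 'N(B | 'P)%g.
    by apply/astabsP => x; rewrite /= -[RHS]Bx.
  (* The first factor is the restriction of [s] to the fibre; removing it from [s] leaves a
     permutation that fixes [B] pointwise. *)
  have rB : restr_perm B s \in Sym B by rewrite inE restr_perm_on.
  exists (restr_perm B s, ((restr_perm B s)^-1 * s)%g); last first.
    by rewrite /= mulKVg.
  apply/setXP; split=> //=; apply/mem_level_perms.
  have BV : (restr_perm B s)^-1%g \in Sym B by rewrite groupV.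
  split=> x; last by rewrite permM gs gSym.
  rewrite permM => rx; have [kx|kx] := eqVneq (g x) k.
    have <- : restr_perm B s ((restr_perm B s)^-1%g x) =
        s ((restr_perm B s)^-1%g x).
      by apply: restr_permE => //; rewrite inE gSym // kx.
    by rewrite permKV.
  by rewrite (SymP _ BV) // on_s // inE negb_or kx.
have [on_t gt] := mem_level_perms _ _ rt.
apply/mem_level_perms; split=> x; rewrite permM; last by rewrite gt gSym.
by rewrite inE negb_or => /andP[kx rx]; rewrite (SymP _ Bs) // on_t.
Qed.

Lemma card_level_perms r : uniq r ->
  #|level_perms r| = (\prod_(k <- r) #|[set x | g x == k]|`!)%N.
Proof.
elim: r => [_|k r IHr /= /andP[rk Ur]]; last first.
  by rewrite big_cons card_level_perms_cons // IHr.
rewrite big_nil -(cards1 (1%g : {perm T})); congr #|pred_of_set _|.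
apply/setP => s; rewrite in_set1; apply/mem_level_perms/eqP => [[on_s _]|->].
  by apply/permP => x; rewrite perm1 on_s.
by split=> x; rewrite perm1.
Qed.

End LevelPermutations.

(** The stabilizer is the product of the symmetric groups of the fibres of [tnth I]; its order is
    the factorial product in [kappa]. *)
Lemma card_tuple_stabilizer (K : eqType) n (I : n.-tuple K) :
  #|[set s : 'S_n | [forall i, tnth I (s i) == tnth I i]]| =
    (\prod_(k <- undup I) (count_mem k I)`!)%N.
Proof.
transitivity #|level_perms (tnth I) (undup I)|.
  congr #|pred_of_set _|; apply/setP => s; rewrite !inE.
  rewrite (_ : perm_on _ s) //; apply/subsetP => i _.
  by rewrite inE mem_undup mem_tnth.
rewrite card_level_perms ?undup_uniq //; apply: eq_bigr => k _; congr _`!.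
by rewrite -sum1_count big_tuple sum1dep_card.
Qed.

(** * Index tuples as sorted words, and their number *)

Section IndexOrder.
Variables (d0 : nat).
Implicit Types (s : seq nat).

(* The sorted words for this relation are the index tuples: weakly increasing,
   with repetitions allowed only among the even indices. *)
Definition idx_lt (x y : nat) := (x < y)%N || (x == y) && (x < d0)%N.

Lemma idx_lt_trans : transitive idx_lt.
Proof.
move=> y x z; rewrite /idx_lt => /orP[xy|/andP[/eqP -> yd]] // .
case/orP=> [yz|/andP[/eqP <- _]]; last by rewrite xy.
by rewrite (ltn_trans xy yz).
Qed.

Lemma idx_lt_leq : subrel idx_lt leq.
Proof. by move=> x y /orP[/ltnW|/andP[/eqP -> _]]. Qed.

Lemma sorted_idx_lt_even s : all (fun x => x < d0)%N s ->
  sorted idx_lt s = sorted leq s.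
Proof.
move=> sd; apply: (eq_in_sorted (P := [pred x | (x < d0)%N]) _ sd) => x y; rewrite !inE => xd _.
by rewrite /idx_lt orbC xd andbT -leq_eqVlt.
Qed.

Lemma sorted_idx_lt_odd s : all (fun x => d0 <= x)%N s ->
  sorted idx_lt s = sorted ltn s.
Proof.
move=> sd; apply: (eq_in_sorted (P := [pred x | (d0 <= x)%N]) _ sd) => x y; rewrite !inE => xd _.
by rewrite /idx_lt [(x < d0)%N]ltnNge xd andbF orbF.
Qed.

Lemma sorted_idx_lt_cat s t :
  all (fun x => x < d0)%N s -> all (fun x => d0 <= x)%N t ->
  sorted idx_lt (s ++ t) = sorted leq s && sorted ltn t.
Proof.
move=> sd td; rewrite (sorted_pairwise idx_lt_trans) pairwise_cat.
rewrite -!(sorted_pairwise idx_lt_trans) sorted_idx_lt_even // sorted_idx_lt_odd //.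
rewrite (_ : allrel _ _ _) //; apply/allrelP => x y /(allP sd) xd /(allP td) dy.
by rewrite /idx_lt (leq_trans xd dy).
Qed.

(** Weak increase already forces the even letters to the front, so their number is the position of
    the cut. *)
Lemma sorted_idx_lt_split s : sorted idx_lt s ->
  let k := count (fun x => x < d0)%N s in
  all (fun x => x < d0)%N (take k s) /\ all (fun x => d0 <= x)%N (drop k s).
Proof.
move=> /(sub_sorted idx_lt_leq); elim: s => //= x s IHs s_sorted.
have [xd|dx] := ltnP x d0; last first.
  have sd : all (fun y => d0 <= y)%N s.
    by apply: sub_all (order_path_min leq_trans s_sorted) => y; apply: leq_trans.
  suff -> : count (fun y => y < d0)%N s = 0%N by rewrite /= dx sd.
  apply/eqP; rewrite -leqn0 leqNgt -has_count; apply/hasPn => y.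
  by move/(allP sd); rewrite leqNgt.
by rewrite /= xd; apply: IHs; apply: path_sorted s_sorted.
Qed.

End IndexOrder.

(** The cut in the definition is determined by the word, so the existential collapses to sortedness
    for one transitive relation. *)
Lemma vee_indexE d0 d1 n (I : n.-tuple 'I_(d0 + d1)) :
  vee_index I = sorted (idx_lt d0) (map val I).
Proof.
rewrite /vee_index; set s := map val I.
have szs : size s = n by rewrite size_map size_tuple.
apply/existsP/idP => [[k /and5P[_ a1 a2 a3 a4]]|s_sorted].
  by rewrite -(cat_take_drop k s) sorted_idx_lt_cat // a2 a4.
have [ev od] := sorted_idx_lt_split s_sorted.
set k := count _ s in ev od.
have lek : (k < n.+1)%N by rewrite ltnS -szs count_size.
exists (Ordinal lek) => /=; rewrite ev od /=.
move: s_sorted; rewrite -{1}(cat_take_drop k s) sorted_idx_lt_cat //.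
case/andP=> -> od_lt; rewrite od_lt /= leq_min leq_subr !andbT.
have <- : size (drop k s) = (n - k)%N by rewrite size_drop szs.
(* The bound by [d1] is automatic: the odd entries are distinct members of an interval of length
   [d1] starting at [d0]. *)
rewrite -[leqRHS](size_iota d0 d1); apply: uniq_leq_size.
  exact: (sorted_uniq ltn_trans ltnn od_lt).
move=> x xs; rewrite mem_iota (allP od) //=.
by have /mapP[i _ ->] := mem_drop xs; apply: ltn_ord.
Qed.

(** The empty alphabet is treated apart, since [card_sorted_tuples] concerns nonempty ones; the
    truncated predecessor then yields 1 for [m = 0] and 0 for [m > 0]. *)
Lemma leq_sorted_tuple_card m d :
  #|[set t : m.-tuple 'I_d | sorted leq (map val t)]| = 'C((d + m).-1, m).
Proof.
case: d => [|d]; last by rewrite card_sorted_tuples addnC addSn.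
case: m => [|m]; last first.
  rewrite bin_small ?add0n //; apply: eq_card0 => t.
  by case: (tnth t ord0) => i; rewrite ltn0.
rewrite bin0 -(cards1 ([tuple] : 0.-tuple 'I_0)); congr #|pred_of_set _|.
by apply/setP => t; rewrite !inE tuple0.
Qed.

(** An index tuple with [k] odd letters is a weakly increasing even word followed by a strictly
    increasing odd word. The words are listed as sequences of naturals, which avoids comparing tuple
    types of different lengths. *)
Lemma card_vee_index d0 d1 n :
  #|[set I : n.-tuple 'I_(d0 + d1) | vee_index I]| =
  (\sum_(k < (minn d1 n).+1) 'C(d1, k) * 'C((d0 + (n - k)).-1, n - k))%N.
Proof.
pose ev k := enum [set t : (n - k).-tuple 'I_d0 | sorted leq (map val t)].
pose od k := enum [set t : k.-tuple 'I_d1 | sorted ltn (map val t)].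
pose nats m d (t : m.-tuple 'I_d) : seq nat := map val t.
have natsI m d : injective (@nats m d).
  by move=> t u /(inj_map val_inj) /val_inj.
pose words k := [seq nats _ _ t ++ map (addn d0) (nats _ _ u) | t <- ev k, u <- od k].
have addI : injective (addn d0) by apply: addnI.
have nats_lt m d (t : m.-tuple 'I_d) x : x \in nats m d t -> (x < d)%N.
  by case/mapP=> i _ ->; apply: ltn_ord.
have nats_ev m (t : m.-tuple 'I_d0) : all (fun x => x < d0)%N (nats m d0 t).
  by apply/allP => x /nats_lt.
have shift_od (s : seq nat) : all (fun x => d0 <= x)%N (map (addn d0) s).
  by apply/allP => x /mapP[y _ ->]; apply: leq_addr.
(* The number of odd letters recovers [k], so the lists for different [k] are disjoint. *)
have count_word k (t : (n - k).-tuple 'I_d0) (u : k.-tuple 'I_d1) :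
    count (fun x => d0 <= x)%N (nats _ _ t ++ map (addn d0) (nats _ _ u)) = k.
  rewrite count_cat -[RHS]add0n; congr (_ + _)%N.
    apply/eqP; rewrite -leqn0 leqNgt -has_count; apply/hasPn => x /nats_lt.
    by rewrite ltnNge.
  move: (shift_od (nats _ _ u)); rewrite all_count => /eqP ->.
  by rewrite !size_map size_tuple.
have words_uniq k : uniq (words k).
  apply: allpairs_uniq; rewrite ?enum_uniq // => -[t u] [t' u'] _ _ /= /eqP.
  rewrite eqseq_cat ?size_map ?size_tuple // => /andP[/eqP/natsI -> /eqP].
  by move/(inj_map addI)/natsI ->.
pose all_words := [seq w | k <- iota 0 (minn d1 n).+1, w <- words k].
have Uall : uniq all_words.
  apply: allpairs_uniq_dep => [|k _|]; rewrite ?iota_uniq //.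
  move=> _ _ /allpairsPdep[k [w [_ kw ->]]] /allpairsPdep[l [w' [_ lw ->]]] /= E.
  subst w'; suff -> : k = l by [].
  case/allpairsP: kw => -[t u] /= [_ _ Ew].
  case/allpairsP: lw => -[t' u'] /= [_ _ Ew'].
  by rewrite -(count_word k t u) -Ew Ew' count_word.
have E : perm_eq all_words
    [seq nats _ _ K | K <- enum [set I : n.-tuple 'I_(d0 + d1) | vee_index I]].
  apply: uniq_perm => //; first by rewrite (map_inj_uniq (@natsI _ _)) enum_uniq.
  move=> w; apply/allpairsPdep/mapP.
    case=> k [_ [kn /allpairsP[[t u] /= [tS uS ->]] ->]].
    move: kn; rewrite mem_iota /= add0n ltnS leq_min => /andP[kd kn].
    move: tS uS; rewrite !mem_enum !inE => tS uS.
    have sz : size (map (lshift d1) t ++ map (@rshift d0 d1) u) == n.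
      by rewrite size_cat !size_map !size_tuple subnK.
    have Ew : map val (Tuple sz) =
        nats _ _ t ++ map (addn d0) (nats _ _ u).
      by rewrite /= map_cat -!map_comp.
    exists (Tuple sz); last by rewrite /nats Ew.
    rewrite mem_enum inE vee_indexE Ew sorted_idx_lt_cat // [sorted leq _]tS.
    by rewrite /= sorted_map; apply: sub_sorted uS => x y /=; rewrite ltn_add2l.
  case=> I; rewrite mem_enum inE vee_indexE => I_sorted ->.
  have [ev_a od_a] := sorted_idx_lt_split I_sorted.
  set s := map val I in I_sorted ev_a od_a; set k := count _ s in ev_a od_a.
  have szs : size s = n by rewrite size_map size_tuple.
  have lek : (k <= n)%N by rewrite -szs count_size.
  have sk : size (take k s) = k by rewrite size_takel ?szs.
  have sd : size (drop k s) = (n - k)%N by rewrite size_drop szs.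
  move: I_sorted; rewrite -{1}(cat_take_drop k s) sorted_idx_lt_cat //.
  case/andP=> ev_s od_s.
  have mk_tuple m d (r : seq nat) : size r = m -> all (fun x => x < d)%N r ->
      exists t : m.-tuple 'I_d, nats _ _ t = r.
    move=> szr rd; have szt : size (pmap insub r : seq 'I_d) == m.
      by rewrite size_pmap_sub -szr -all_count.
    exists (Tuple szt); rewrite /nats /= -[RHS]map_id.
    elim: r rd {szr szt} => //= x r IHr /andP[xd /IHr] E.
    by rewrite insubT /= E.
  (* Here [k] counts even letters, so the index of the block is [n - k] and its even words have
     length [n - (n - k)]. *)
  have [t Et] := mk_tuple (n - (n - k))%N d0 _ (etrans sk (esym (subKn lek))) ev_a.
  have od_d : all (fun x => x < d1)%N (map (subn^~ d0) (drop k s)).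
    rewrite all_map; apply/allP => x xs /=.
    have /mapP[i _ Ei] := mem_drop xs.
    rewrite ltn_subLR ?Ei //; last by rewrite -Ei (allP od_a).
    exact: ltn_ord.
  have szo : size (map (subn^~ d0) (drop k s)) = (n - k)%N by rewrite size_map.
  have [u Eu] := mk_tuple (n - k)%N d1 _ szo od_d.
  have Eu' : map (addn d0) (nats _ _ u) = drop k s.
    rewrite Eu -map_comp -[RHS]map_id; apply/eq_in_map => x xs /=.
    by rewrite subnKC // (allP od_a).
  exists (n - k)%N, s; split=> //; last first.
    apply/allpairsP; exists (t, u); rewrite /= !mem_enum !inE.
    rewrite -!/(nats _ _ _) Et ev_s Eu' cat_take_drop; split=> //.
    move: od_s; rewrite -Eu' sorted_map; apply: sub_sorted => x y /=.
    by rewrite ltn_add2l.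
  (* Distinct odd letters number at most [d1], which puts [n - k] in the range of summation. *)
  have Uu : uniq u.
    have: uniq (map (addn d0) (nats _ _ u)).
      by rewrite Eu'; apply: (sorted_uniq ltn_trans ltnn).
    by rewrite (map_inj_uniq addI) (map_inj_uniq val_inj).
  rewrite mem_iota /= add0n ltnS leq_min leq_subr andbT.
  by have := max_card (mem u); rewrite (card_uniqP Uu) size_tuple card_ord.
rewrite cardE -(size_map (@nats _ _)) -(perm_size E) size_allpairs_dep sumnE.
rewrite big_map -[X in iota 0 X]subn0 -/(index_iota _ _) big_mkord; apply: eq_bigr => k _.
rewrite size_allpairs -!cardE leq_sorted_tuple_card card_ltn_sorted_tuples.
exact: mulnC.
Qed.

(** * Bases of the symmetric power *)

Section DualFamilies.
Variables (F : fieldType) (P Q : vectType F) (T : finType) (A : {set T}).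
Variables (e : T -> P) (g : T -> Q) (B : P -> Q -> F) (c : T -> F).
Hypothesis B_linearl : forall q, linear (B^~ q : P -> F^o).
Hypothesis B_gram : forall I J, I \in A -> J \in A ->
  B (e I) (g J) = if I == J then c I else 0.
Hypothesis c_neq0 : forall I, I \in A -> c I != 0.

Lemma linearl_sum I (r : seq I) (p : pred I) (a : I -> F) x q :
  B (\sum_(i <- r | p i) a i *: x i) q = \sum_(i <- r | p i) a i * B (x i) q.
Proof.
elim/big_rec2: _ => [|i y z _ <-]; last exact: B_linearl.
by have := linear_scale 0 0 (B_linearl q); rewrite !scale0r.
Qed.

Lemma span_family_sum p : p \in <<[seq e K | K <- enum A]>>%VS ->
  exists a : T -> F, p = \sum_(K in A) a K *: e K.
Proof.
rewrite span_def big_map big_enum => /memv_sumP[w Hw ->].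
have [a Ha] : exists a : T -> F, forall K, K \in A -> w K = a K *: e K.
  apply: (@fin_all_exists T (fun _ => F) (fun K x => K \in A -> w K = x *: e K)).
  move=> K; have [KA|_] := boolP (K \in A); last by exists 0.
  by have /vlineP[x ->] := Hw K KA; exists x.
by exists a; apply: eq_bigr.
Qed.

(** Orthogonality leaves only the term of index [J]; nondegeneracy and the inverse of the map into
    the dual are read off from this. *)
Lemma dual_family_coef (a : T -> F) J : J \in A ->
  B (\sum_(K in A) a K *: e K) (g J) = a J * c J.
Proof.
move=> JA; rewrite linearl_sum (bigD1 J) //= big1 => [|K].
  by rewrite addr0 B_gram // eqxx.
by case/andP=> KA ne_K; rewrite B_gram // (negPf ne_K) mulr0.
Qed.

Lemma dual_family_eq0 p : <<[seq e K | K <- enum A]>>%VS = fullv ->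
  (forall J, J \in A -> B p (g J) = 0) -> p = 0.
Proof.
move=> eT; have /span_family_sum[a ->] : p \in <<[seq e K | K <- enum A]>>%VS.
  by rewrite eT memvf.
move=> p0; apply: big1 => K KA; have /eqP := p0 K KA.
by rewrite dual_family_coef // mulf_eq0 (negPf (c_neq0 KA)) orbF => /eqP ->; rewrite scale0r.
Qed.

(** Pairing a vanishing combination with one [g J] leaves a single coefficient times a nonzero
    scalar, which gives independence. *)
Lemma dual_family_basis : <<[seq e K | K <- enum A]>>%VS = fullv ->
  basis_of {:P} [seq e K | K <- enum A].
Proof.
move=> eT; rewrite /basis_of eT eqxx /=.
rewrite -[map _ _]/(val (map_tuple e (enum_tuple A))).
apply/freeP => a a0 j; set E := enum_tuple A in a0.
have EA i : tnth E i \in A by rewrite -mem_enum; apply: mem_tnth.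
have Einj : injective (tnth E) by apply/tuple_uniqP/enum_uniq.
have: B (\sum_i a i *: (map_tuple e E)`_i) (g (tnth E j)) = a j * c (tnth E j).
  rewrite linearl_sum (bigD1 j) //= big1 => [|i ne_ij].
    by rewrite addr0 -tnth_nth tnth_map B_gram // eqxx.
  by rewrite -tnth_nth tnth_map B_gram // (inj_eq Einj) (negPf ne_ij) mulr0.
rewrite a0; have := linear_scale 0 0 (B_linearl (g (tnth E j))).
rewrite !scale0r => -> /esym/eqP.
by rewrite mulf_eq0 (negPf (c_neq0 (EA j))) orbF => /eqP.
Qed.

End DualFamilies.

(** * Sorted products of basis vectors span *)

Section Spanning.
Variables (F : fieldType) (n : nat) (V : superspace F).
Hypothesis two_neq0 : 2%:R != 0 :> F.
Implicit Types (v : {ffun 'I_n -> V}) (s : 'S_n).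

Lemma multilinear_vee : multilinear (@vee F n V).
Proof. by move=> i v a x y; rewrite /vee multilinear_tens linearP. Qed.

Lemma vee_perm s e v : homogs e v ->
  vee v = koszul F s e *: vee [ffun i => v (s^-1%g i)].
Proof. by move=> ev; rewrite /vee -(vpi_sact s) (sact_tens _ ev) linearZ. Qed.

(** Exchanging the two equal odd factors multiplies the class by -1, and 2 is invertible. *)
Lemma vee_repeated_odd e v (i j : 'I_n) : val j = i.+1 -> homogs e v ->
  e i -> e j -> v i = v j -> vee v = 0.
Proof.
move=> ij ev ei ej vij.
have: vee v = - vee v.
  rewrite {1}/vee -(vpi_sact (tperm i j)) (sact_tperm ij ev) ei ej linearZ.
  rewrite /eta /= expr1 scaleN1r; congr (- vpi _ (tens _)); apply/ffunP => k.
  by rewrite ffunE; case: tpermP => [->|->|].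
move/eqP; rewrite -addr_eq0 -mulr2n -scaler_nat scaler_eq0 (negPf two_neq0).
by move/eqP.
Qed.

Variables (d0 d1 : nat) (u : (d0 + d1).-tuple V).
Hypothesis u_homog : forall i : 'I_(d0 + d1), homog V (d0 <= i)%N (tnth u i).
Hypothesis u_span : <<u>>%VS = fullv.
Implicit Types I J : n.-tuple 'I_(d0 + d1).

Definition tuple_parity I : {ffun 'I_n -> bool} := [ffun a => (d0 <= tnth I a)%N].

Lemma homogs_tuple I : homogs (tuple_parity I) [ffun a => tnth u (tnth I a)].
Proof. by move=> a; rewrite !ffunE. Qed.

Lemma vee_family_perm I J : perm_eq I J ->
  exists a : F, vee_family u I = a *: vee_family u J.
Proof.
rewrite perm_sym => /tuple_permP[s EJ].
have J_s : J = [tuple tnth I (s i) | i < n] by apply: val_inj.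
exists (koszul F s^-1%g (tuple_parity I)).
rewrite /vee_family (vee_perm s^-1%g (homogs_tuple I)) J_s invgK.
by congr (_ *: vee _); apply/ffunP => i; rewrite !ffunE tnth_mktuple.
Qed.

(** A weakly increasing word that fails to be an index tuple repeats an odd letter in adjacent
    places. *)
Lemma vee_family_sorted I : sorted leq (map val I) ->
  ~~ vee_index I -> vee_family u I = 0.
Proof.
move=> /(sortedP 0%N) I_sorted; apply: contraNeq => vI.
rewrite vee_indexE; apply/(sortedP 0%N) => k; rewrite size_map size_tuple => ltkn.
have szs : size (map val I) = n by rewrite size_map size_tuple.
have := I_sorted k; rewrite szs => /(_ ltkn); rewrite /idx_lt leq_eqVlt orbC.
pose i := Ordinal (ltnW ltkn); pose j := Ordinal ltkn.
have nthI (a : 'I_n) : nth 0%N (map val I) a = tnth I a.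
  by rewrite (nth_map (tnth I a)) ?size_tuple // -tnth_nth.
rewrite -[k]/(val i) -[(val i).+1]/(val j) !nthI.
case/orP=> [->//|/eqP/val_inj Iij]; rewrite Iij eqxx ltnn /= ltnNge.
apply: contraNN vI => dj; apply/eqP.
by apply: (vee_repeated_odd (i := i) (j := j) _ (homogs_tuple I)); rewrite ?ffunE ?Iij.
Qed.

Lemma vee_family_in_span I : vee_family u I \in
  <<[seq vee_family u K | K <- enum [set K : n.-tuple 'I_(d0 + d1) | vee_index K]]>>%VS.
Proof.
have szJ : size (sort (relpre val leq) I) == n by rewrite size_sort size_tuple.
have [a ->] : exists a : F, vee_family u I = a *: vee_family u (Tuple szJ).
  by apply: vee_family_perm; rewrite perm_sym perm_sort.
rewrite memvZ //; set J := Tuple szJ.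
have J_sorted : sorted leq (map val J).
  by rewrite sorted_map; apply: sort_sorted => x y; apply: leq_total.
have [J_idx|/(vee_family_sorted J_sorted) ->] := boolP (vee_index J).
  by apply/memv_span/map_f; rewrite mem_enum inE.
exact: mem0v.
Qed.

Lemma vee_family_span :
  <<[seq vee_family u K | K <- enum [set K : n.-tuple 'I_(d0 + d1) | vee_index K]]>>%VS
  = fullv.
Proof.
set U := <<_>>%VS; apply/vspaceP => q; rewrite memvf.
suff vU v : vee v \in U.
  rewrite -[q]vreprK -(tlift_tensK (vrepr q)) /tlift linear_sum.
  by apply: rpred_sum => s _; rewrite linearZ memvZ //; apply: vU.
(* Membership in [U] becomes vanishing in the quotient by [U], an identity of multilinear maps,
   which need only be checked on the vectors of [u]. *)
suff: vpi U (vee v) == vpi U 0 by rewrite vpi_eq subr0.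
rewrite linear0.
have gen_u : gen (fun x : V => exists i, x = tnth u i).
  move=> p p0 pD pu x; have: x \in <<u>>%VS by rewrite u_span memvf.
  move=> /coord_span ->; elim/big_rec: _ => // i y _ py; apply: pD => //.
  by apply: pu; exists i; rewrite (tnth_nth 0).
apply/eqP; apply: (multilinear_ext (f := vpi U \o @vee F n V) (g := fun=> 0) gen_u).
- by move=> i w a x y /=; rewrite multilinear_vee linearP.
- by move=> i w a x y; rewrite scaler0 addr0.
move=> {}v /fin_all_exists[s Es] /=; apply/eqP; rewrite -(linear0 (vpi U)) vpi_eq subr0.
have -> : v = [ffun a => tnth u (tnth [tuple s i | i < n] a)].
  by apply/ffunP => a; rewrite ffunE tnth_mktuple.
exact: vee_family_in_span.
Qed.

End Spanning.

(** * Gram matrix of the sorted products *)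

(** A pair contributes -1 exactly when both positions are odd, so the exponent counts pairs of odd
    positions. Parities live on [nat] so that the induction can drop the last position. *)
Lemma prod_eta_pairs (F : fieldType) n (e : nat -> bool) :
  \prod_(i < n) \prod_(j < n | (j < i)%N) eta F (e i) (e j) =
  omega F (\sum_(i < n) e i)%N.
Proof.
pose E m := \sum_(i < m) (e i : nat).
transitivity (\prod_(i < n) \prod_(j < i) eta F (e i) (e j)).
  apply: eq_bigr => i _; rewrite (big_ord_widen n (fun j => eta F (e i) (e j))) //.
  exact: ltnW.
have sq m : ((m * m.-1)./2 = 'C(m, 2))%N by rewrite bin2.
rewrite /omega sq; elim: n => [|m IHm]; first by rewrite !big_ord0.
rewrite !big_ord_recr /= IHm.
have -> : \prod_(j < m) eta F (e m) (e j) = (-1) ^+ (e m * E m)%N.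
  rewrite /E big_distrr /= -prodrXr; apply: eq_bigr => j _.
  by rewrite /eta mulnb.
rewrite -exprD; congr (_ ^+ _); case: (e m); last by rewrite mul0n !addn0.
by rewrite mul1n addn1 binS bin1.
Qed.

Lemma count_tuple (T : eqType) n (I : n.-tuple T) (p : pred T) :
  count p I = (\sum_(i < n) p (tnth I i))%N.
Proof. by rewrite -sum1_count big_mkcond big_tuple; apply: eq_bigr => i _; case: (p _). Qed.

Lemma tform_tens (F : fieldType) n (V : superspace F) e' e
    (fs : {ffun 'I_n -> dual_super V}) (vs : {ffun 'I_n -> V}) :
  homogs e' fs -> homogs e vs ->
  tform (tens fs) (tens vs) = \sum_(s : 'S_n) koszul F s e *
    ((\prod_(i < n) \prod_(j < n | (j < i)%N) eta F (e' i) (e (s^-1 j)%g)) *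
     (\prod_i fs i (vs (s^-1 i)%g))).
Proof.
move=> ef ev; apply: eq_bigr => s _; rewrite (sact_tens s ev).
rewrite (linear_scale _ _ (tpair_linearr _)) (tpair_tens ef (homogs_perm s^-1%g ev)).
congr (_ * (_ * _)); last by apply: eq_bigr => i _; rewrite ffunE.
by apply: eq_bigr => i _; apply: eq_bigr => j _; rewrite ffunE.
Qed.

(** In characteristic [p] each factor of the factorial lies strictly between 0 and [p]. *)
Lemma fact_neq0 (F : fieldType) n :
  [pchar F] =i pred0 \/ (exists2 p, p \in [pchar F] & (n < p)%N) ->
  forall m, (m <= n)%N -> (m`!)%:R != 0 :> F.
Proof.
move=> hF m; elim: m => [_|m IHm ltmn]; first exact: oner_neq0.
rewrite factS natrM mulf_neq0 ?IHm 1?ltnW //.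
case: hF => [/pcharf0P -> //|[p pF ltnp]].
by rewrite -(dvdn_pcharf pF) gtnNdvd // (leq_ltn_trans ltmn).
Qed.

Section GramMatrix.
Variables (F : fieldType) (n : nat) (V : superspace F) (d0 d1 : nat).
Variables (u : (d0 + d1).-tuple V) (f : (d0 + d1).-tuple (dual_super V)).
Hypothesis u_homog : forall i : 'I_(d0 + d1), homog V (d0 <= i)%N (tnth u i).
Hypothesis f_homog : forall i : 'I_(d0 + d1), homog (dual_super V) (d0 <= i)%N (tnth f i).
Hypothesis f_dual : forall i j, tnth f i (tnth u j) = (i == j)%:R.
Implicit Types I J : n.-tuple 'I_(d0 + d1).

Lemma vee_index_sorted I : vee_index I -> sorted leq (map val I).
Proof. by rewrite vee_indexE; apply: sub_sorted; apply: idx_lt_leq. Qed.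

(** Entries at distinct positions are related by [idx_lt], which is irreflexive on odd letters. *)
Lemma vee_index_odd_inj I (i j : 'I_n) : vee_index I ->
  tnth I i = tnth I j -> (d0 <= tnth I i)%N -> i = j.
Proof.
rewrite vee_indexE => I_sorted; wlog ltij : i j / (i < j)%N => [hw Iij di|].
  case: (ltngtP i j) => [lt|lt|/val_inj //]; first exact: hw.
  by apply/esym/hw => //; rewrite -?Iij.
have nthI (a : 'I_n) : nth 0%N (map val I) a = tnth I a.
  by rewrite (nth_map (tnth I a)) ?size_tuple // -tnth_nth.
have := sorted_ltn_nth (@idx_lt_trans d0) 0%N I_sorted.
move=> /(_ i j); rewrite !inE size_map size_tuple => /(_ (ltn_ord i) (ltn_ord j) ltij).
rewrite !nthI => + Iij; rewrite -Iij /idx_lt ltnn eqxx /= ltnNge.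
by case: leqP.
Qed.

(** Odd letters do not repeat, so [s] fixes every odd position and inverts no pair of odd
    positions. *)
Lemma koszul_stabilizer I (s : 'S_n) : vee_index I ->
  (forall i, tnth I (s i) = tnth I i) -> koszul F s (tuple_parity I) = 1.
Proof.
move=> I_idx Is; rewrite /koszul big1 // => i _; apply: big1 => j /andP[ij sji].
rewrite !ffunE /eta; case: leqP => //= di; case: leqP => //= dj.
have fix_odd k : (d0 <= tnth I k)%N -> s k = k.
  by move=> dk; apply: (vee_index_odd_inj I_idx); rewrite Is.
by move: sji; rewrite !fix_odd // ltnNge ltnW.
Qed.

Lemma vform_family I J : vee_index I -> vee_index J ->
  vform (vee_family f I) (vee_family u J) = if I == J then kappa F I else 0.
Proof.
move=> I_idx J_idx; rewrite vformE.
rewrite (tform_tens (homogs_tuple f_homog I) (homogs_tuple u_homog J)).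
(* By duality of the bases the product is the indicator of [s] carrying [I] to [J]. *)
have prodE (s : 'S_n) : \prod_i [ffun a => tnth f (tnth I a)] i
      ([ffun a => tnth u (tnth J a)] (s^-1 i)%g) =
    [forall i, tnth I (s i) == tnth J i]%:R :> F.
  rewrite (reindex_inj (@perm_inj _ s)) /=.
  under eq_bigr => i _ do rewrite !ffunE permK f_dual.
  case: forallP => [Is|/forallP]; first by rewrite big1 // => i _; rewrite Is.
  rewrite negb_forall => /existsP[i /negPf ne_i].
  by rewrite (bigD1 i) //= ne_i mul0r.
under eq_bigr => s _ do rewrite prodE.
have [<-|ne_IJ] := eqVneq I J; last first.
  apply: big1 => s _; case: forallP => [Is|_]; last by rewrite !mulr0.
  (* A contributing permutation rearranges one word into the other; both are weakly increasing,
     hence equal. *)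
  case/eqP: ne_IJ; apply/val_inj/(inj_map val_inj).
  apply: (sorted_eq leq_trans anti_leq); rewrite ?vee_index_sorted //.
  rewrite perm_sym; apply/perm_map/tuple_permP; exists s; congr val.
  by apply: eq_from_tnth => i; rewrite tnth_mktuple (eqP (Is i)).
rewrite (bigID (fun s : 'S_n => [forall i, tnth I (s i) == tnth I i])) /=.
rewrite [X in _ + X]big1 ?addr0 => [|s /negPf ->]; last by rewrite !mulr0.
rewrite (eq_bigr (fun=> omega F (count (fun i : 'I_(d0 + d1) => d0 <= i)%N I))).
  rewrite sumr_const /kappa -card_tuple_stabilizer mulr_natr; congr (_ *+ _).
  by rewrite cardsE.
move=> s s_stab; rewrite s_stab mulr1; have {}s_stab i : tnth I (s i) = tnth I i.
  exact/eqP/(forallP s_stab).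
rewrite koszul_stabilizer // mul1r count_tuple.
(* The parities are extended to all naturals, with default [false], to fit [prod_eta_pairs]. *)
pose e k := if insub k is Some i then tuple_parity I i else false.
have eE (i : 'I_n) : e i = (d0 <= tnth I i)%N by rewrite /e valK ffunE.
under [in RHS]eq_bigr => i _ do rewrite -eE.
rewrite -prod_eta_pairs; apply: eq_bigr => i _; apply: eq_bigr => j _.
by rewrite !eE !ffunE -[in LHS](s_stab (s^-1 j)%g) permKV.
Qed.

(** For [d0 = 0] all entries are odd, so multiplicities are at most 1; otherwise they are at most
    [n] and the assumption on the characteristic applies. *)
Lemma kappa_neq0 I : vee_index I ->
  ((0 < d0)%N -> [pchar F] =i pred0 \/ exists2 p, p \in [pchar F] & (n < p)%N) ->
  kappa F I != 0.
Proof.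
move=> I_idx hF; rewrite mulf_neq0 ?signr_eq0 // natr_prod.
rewrite prodf_seq_neq0; apply/allP => i _ /=.
case: (posnP d0) => [d00|/hF/fact_neq0]; last first.
  by apply; rewrite -[leqRHS](size_tuple I) count_size.
have Uq : uniq I.
  apply/tuple_uniqP => a b Iab; apply: (vee_index_odd_inj I_idx Iab).
  by rewrite [leqLHS]d00.
by rewrite (count_uniq_mem _ Uq); case: (_ \in _); apply: oner_neq0.
Qed.

End GramMatrix.

(** * Invariance of the form *)

Lemma homog_ext (F : fieldType) (V W : lmodType F) (g : grading V) (h k : V -> W) :
  linear h -> linear k -> (forall b x, homog g b x -> h x = k x) -> h =1 k.
Proof.
move=> hL kL hk x; rewrite -(gproj_sum g x) -[gproj g false x]scale1r hL kL.
by rewrite !(hk _ _ (homog_gproj _ _ _)).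
Qed.

Section Parity.
Variables (F : fieldType) (n : nat) (V : superspace F).

Lemma eta_parity_sum b (e : {ffun 'I_n -> bool}) :
  eta F b (parity_sum e) = \prod_i eta F b (e i).
Proof.
rewrite /parity_sum; elim/big_rec2: _ => [|i x y _ <-]; last exact: eta_addr.
by rewrite /eta andbF.
Qed.

Lemma dual_homog_eq0 b c (f : dual_super V) (w : V) :
  homog (dual_super V) b f -> homog V c w -> b != c -> f w = 0.
Proof. by move=> /homog_dual bf cw ne; apply: bf cw _; rewrite eq_sym. Qed.

Lemma tpair0l (t : tpow n V) : tpair 0 t = 0.
Proof. by have := linear_scale 0 0 (tpair_linearl t); rewrite !scale0r. Qed.

Lemma tpair0r (f : tpow n (dual_super V)) : tpair f 0 = 0.
Proof. by have := linear_scale 0 0 (tpair_linearr f); rewrite !scale0r. Qed.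

Lemma tpair_suml (I : Type) (r : seq I) (a : I -> tpow n (dual_super V)) (t : tpow n V) :
  tpair (\sum_(i <- r) a i) t = \sum_(i <- r) tpair (a i) t.
Proof.
elim/big_rec2: _ => [|i y z _ <-]; first exact: tpair0l.
by rewrite -[a i]scale1r tpair_linearl !scale1r.
Qed.

Lemma tpair_sumr (I : Type) (r : seq I) (f : tpow n (dual_super V)) (a : I -> tpow n V) :
  tpair f (\sum_(i <- r) a i) = \sum_(i <- r) tpair f (a i).
Proof.
elim/big_rec2: _ => [|i y z _ <-]; first exact: tpair0r.
by rewrite -[a i]scale1r tpair_linearr !scale1r.
Qed.

(** If the total parities differ, some functional meets a vector of the other parity and the product
    vanishes. *)
Lemma tpair_tproj b c (f : tpow n (dual_super V)) (t : tpow n V) :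
  b != c -> tpair (tproj b f) (tproj c t) = 0.
Proof.
move=> ne_bc; move: f; apply: hext => [a f g|a f g|e' fs ef].
- by rewrite linearP tpair_linearl.
- by rewrite scaler0 addr0.
move: t; apply: hext => [a t w|a t w|e vs ev].
- by rewrite linearP tpair_linearr.
- by rewrite scaler0 addr0.
rewrite (tproj_tens b ef) (tproj_tens c ev).
case: eqP => [Eb|_]; last exact: tpair0l.
case: eqP => [Ec|_]; last exact: tpair0r.
rewrite (tpair_tens ef ev).
have [i ne_i|eq_e] := pickP (fun i => e' i != e i).
  by rewrite [X in _ * X](bigD1 i) //= (dual_homog_eq0 (ef i) (ev i)) // mul0r mulr0.
case/eqP: ne_bc; rewrite -Eb -Ec; congr parity_sum.
by apply/ffunP => i; apply/eqP; rewrite -[_ == _]negbK eq_e.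
Qed.

Lemma vform_homog_eq0 b c (f : vee_super n (dual_super V)) (q : vee_super n V) :
  homog (vee_super n (dual_super V)) b f -> homog (vee_super n V) c q ->
  b != c -> vform f q = 0.
Proof.
move=> <- <- ne_bc; rewrite -[f]vreprK -[q]vreprK /= !vproj_vpi vformE.
by apply: big1 => s _; rewrite -tproj_sact tpair_tproj.
Qed.

End Parity.

Section Invariance.
Variables (F : fieldType) (L : lieSuperalgebra F) (M : supermodule L) (n : nat).
Implicit Types (e : {ffun 'I_n -> bool}) (i j k : 'I_n) (x : L).

(** Slot [i] of the functionals meets the vectors before it, and only these signs change; in
    [prod_eta_updr], slot [i] of the vectors meets the functionals after it. *)
Lemma prod_eta_updl e' e i b :
  \prod_(p < n) \prod_(q < n | (q < p)%N) eta F (updp e' i (b (+) e' i) p) (e q) =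
  \prod_(q < n | (q < i)%N) eta F b (e q) *
    \prod_(p < n) \prod_(q < n | (q < p)%N) eta F (e' p) (e q).
Proof.
rewrite (bigD1 i) //= [X in _ = _ * X](bigD1 i) //= mulrA; congr (_ * _).
  by rewrite -big_split; apply: eq_bigr => q _; rewrite ffunE eqxx eta_addl.
apply: eq_bigr => p /negPf ne; apply: eq_bigr => q _.
by rewrite ffunE ne.
Qed.

Lemma prod_eta_updr e' e i b :
  \prod_(p < n) \prod_(q < n | (q < p)%N) eta F (e' p) (updp e i (b (+) e i) q) =
  \prod_(p < n | (i < p)%N) eta F b (e' p) *
    \prod_(p < n) \prod_(q < n | (q < p)%N) eta F (e' p) (e q).
Proof.
rewrite [X in _ = X * _]big_mkcond -big_split; apply: eq_bigr => p _ /=.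
by rewrite sign_upd [eta F b _]etaC.
Qed.

(** Both sides are sums over the slot acted on, and their terms agree one by one. *)
Lemma tpair_tact_tens b x e' e (fs : {ffun 'I_n -> dual_super M})
    (vs : {ffun 'I_n -> M}) :
  homog L b x -> homogs e' fs -> homogs e vs ->
  tpair (tact (M := dual_module M) x (tens fs)) (tens vs) =
    - (eta F b (parity_sum e') * tpair (tens fs) (tact x (tens vs))).
Proof.
move=> bx ef ev.
rewrite (tact_tens (M := dual_module M) bx ef) (tact_tens bx ev).
rewrite tpair_suml tpair_sumr mulr_sumr -sumrN; apply: eq_bigr => i _; rewrite /tact_term.
rewrite (linear_scale _ _ (tpair_linearl _)) (linear_scale _ _ (tpair_linearr _)).
rewrite (tpair_tens (homogs_act (M := dual_module M) i bx ef) ev).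
rewrite (tpair_tens ef (homogs_act i bx ev)) prod_eta_updl prod_eta_updr.
rewrite (prod_upd (fun k (g : dual_super M) => g (vs k))).
rewrite (prod_upd (fun k w => fs k w)) /= (dact_homogE _ bx (ef i)).
(* A parity mismatch at a slot other than [i] kills both terms. *)
have [k|eq_e] := pickP (fun k => (k != i) && (e' k != e k)).
  case/andP=> ne_ki ne_k.
  rewrite [\prod_(k | k != i) _](bigD1 k) //= (dual_homog_eq0 (ef k) (ev k)) //.
  by rewrite !(mul0r, mulr0) /GRing.scale /= !(mul0r, mulr0) oppr0.
have {}eq_e k : k != i -> e k = e' k.
  by move=> ne; apply/esym/eqP; move: (eq_e k); rewrite ne => /negbFE.
set Y := \prod_(k | k != i) _; set X := \prod_(p < n) _.
have -> : \prod_(q < n | (q < i)%N) eta F b (e q) =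
    \prod_(q < n | (q < i)%N) eta F b (e' q).
  by apply: eq_bigr => q lt; rewrite eq_e // neq_ltn lt.
rewrite eta_parity_sum.
set A := \prod_(q < n | (q < i)%N) _; set C := \prod_(p < n | (i < p)%N) _.
(* The sign of the total parity splits into the slots at, before and after [i]. *)
have -> : \prod_k eta F b (e' k) = eta F b (e' i) * (A * C).
  rewrite (bigD1 i) //= (bigID (fun k : 'I_n => (k < i)%N)) /=.
  by congr (_ * (_ * _)); apply: eq_bigl => k; rewrite -(inj_eq val_inj) /=; case: ltngtP.
(* As e and e' agree away from i, both sides carry the sign eta b (e' i). *)
have AA : A * A = 1 by rewrite -big_split big1 // => k _; apply: eta_sq.
have CC : C * C = 1 by rewrite -big_split big1 // => k _; apply: eta_sq.
rewrite /GRing.scale /= !(mulrN, mulNr); congr (- _).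
have alg (h z : F) : A * (A * X * (h * z * Y)) = h * (A * C) * (A * (C * X * (z * Y))).
  transitivity ((A * A) * (X * h * z * Y)); first by ring.
  transitivity ((A * A) * (C * C) * (X * h * z * Y)); last by ring.
  by rewrite AA CC mulr1.
exact: alg.
Qed.

(** Inserting [tproj c] makes the sign constant, so both sides are linear in [f] and homogeneous
    tensors suffice. *)
Lemma tpair_tact b c x (f : tpow n (dual_super M)) (t : tpow n M) : homog L b x ->
  tpair (tact (M := dual_module M) x (tproj c f)) t =
    - (eta F b c * tpair (tproj c f) (tact x t)).
Proof.
move=> bx.
have lin w : linear (fun g : tpow n (dual_super M) =>
    tpair (tact (M := dual_module M) x (tproj c g)) w : F^o).
  by move=> a g h; rewrite !linearP tpair_linearl.
have lin' w : linear (fun g : tpow n (dual_super M) =>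
    - (eta F b c * tpair (tproj c g) w) : F^o).
  move=> a g h; rewrite linearP tpair_linearl mulrDr opprD; congr (_ + _).
  by rewrite /GRing.scale /= mulrCA mulrN.
move: f; apply: (hext (lin _) (lin' _)) => e' fs ef.
move: t; apply: hext => [a t w|a t w|e vs ev].
- by rewrite tpair_linearr.
- rewrite linearP tpair_linearr mulrDr opprD; congr (_ + _).
  by rewrite /GRing.scale /= mulrCA mulrN.
rewrite (tproj_tens c ef); case: eqP => [<-|_]; first exact: tpair_tact_tens ef ev.
by rewrite linear0 !tpair0l mulr0 oppr0.
Qed.

(** The action commutes with permutations, so invariance passes to each summand of the form. *)
Lemma vform_vact b c x (f : vee_super n (dual_super M)) (q : vee_super n M) :
  homog L b x -> homog (vee_super n (dual_super M)) c f ->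
  vform (vact (M := dual_module M) x f) q = - (eta F b c * vform f (vact x q)).
Proof.
move=> bx <-; rewrite -[f]vreprK -[q]vreprK /= vproj_vpi !vact_vpi !vformE.
move: (vrepr f) (vrepr q) => {}f t.
rewrite /tform mulr_sumr -sumrN; apply: eq_bigr => s _.
by rewrite (tpair_tact c f (sact s t) bx) tact_sact.
Qed.

Lemma vee_form_pairing : supermodule_pairing (@vee_form F L M n).
Proof.
split; first exact: vform_bilinear.
by move=> b c x f q bx cf; apply: vform_vact bx cf.
Qed.

Lemma vee_form_map_linear : linear (@vee_form_map F L M n).
Proof.
move=> a f g; apply/lfunP => q.
by rewrite add_lfunE scale_lfunE !vee_form_mapE /vee_form (vform_bilinear n M).1.
Qed.

Lemma vee_form_map_homog b f : homog (vee_module (dual_module M) n) b f ->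
  homog (dual_module (vee_module M n)) b (vee_form_map f).
Proof.
move=> bf; apply/homog_dual => c q cq ne_cb.
by rewrite vee_form_mapE; apply: (vform_homog_eq0 bf cq); rewrite eq_sym.
Qed.

(** On homogeneous arguments the dual action carries the same sign as the invariance of the form;
    linearity does the rest. *)
Lemma vee_form_map_act x (f : vee_module (dual_module M) n) :
  vee_form_map (sm_act x f) = sm_act x (vee_form_map f).
Proof.
move: f; apply: (homog_ext (g := vee_module (dual_module M) n)) => [a f g|a f g|c f cf].
- by rewrite sm_act_linearr vee_form_map_linear.
- by rewrite vee_form_map_linear sm_act_linearr.
move: x; apply: (homog_ext (g := L)) => [a x y|a x y|b x bx].
- by rewrite sm_act_linearl vee_form_map_linear.
- by rewrite sm_act_linearl.
apply/lfunP => q.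
rewrite [RHS](dact_homogE (M := vee_module M n) _ bx (vee_form_map_homog cf)).
rewrite !vee_form_mapE; exact: (vform_vact q bx cf).
Qed.

End Invariance.

(** * Nondegeneracy and the isomorphism with the dual *)

Section Isomorphism.
Variables (F : fieldType) (L : lieSuperalgebra F) (M : supermodule L) (n : nat).
Variables (T : finType) (A : {set T}).
Variables (e : T -> vee_module (dual_module M) n) (g : T -> vee_module M n) (c : T -> F).
Hypothesis e_span : <<[seq e K | K <- enum A]>>%VS = fullv.
Hypothesis g_span : <<[seq g K | K <- enum A]>>%VS = fullv.
Hypothesis gram : forall I J, I \in A -> J \in A ->
  vee_form (e I) (g J) = if I == J then c I else 0.
Hypothesis c_neq0 : forall I, I \in A -> c I != 0.

Let form_linearl : forall q, linear ((@vee_form F L M n)^~ q : vee_module (dual_module M) n -> F^o) :=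
  (vform_bilinear n M).1.
Let form_linearr : forall f, linear (vee_form f : vee_module M n -> F^o) :=
  (vform_bilinear n M).2.
Let gram_sym I J : I \in A -> J \in A ->
  vee_form (e J) (g I) = if I == J then c I else 0.
Proof. by move=> IA JA; rewrite gram // eq_sym; case: eqP => [->|]. Qed.

(** The two halves are one lemma, applied to the form and to its transpose. *)
Lemma vee_form_nondegenerate : nondegenerate_pairing (@vee_form F L M n).
Proof.
split=> [f f0|q q0].
  by apply: (dual_family_eq0 form_linearl gram c_neq0 e_span) => J _; apply: f0.
apply: (dual_family_eq0 (B := fun q f => @vee_form F L M n f q) form_linearr gram_sym) => //.
Qed.

Lemma vee_form_bases :
  basis_of {:vee_module M n} [seq g K | K <- enum A] /\
  basis_of {:vee_module (dual_module M) n} [seq e K | K <- enum A].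
Proof.
split; last exact: (dual_family_basis form_linearl gram).
apply: (dual_family_basis (B := fun q f => @vee_form F L M n f q) form_linearr gram_sym) => //.
Qed.

Lemma vee_form_map_inj : injective (@vee_form_map F L M n).
Proof.
move=> f f' E; apply/eqP; rewrite -subr_eq0; apply/eqP.
apply: vee_form_nondegenerate.1 => q.
rewrite -vee_form_mapE -scaleN1r addrC vee_form_map_linear E.
by rewrite scaleN1r addNr zero_lfunE.
Qed.

Lemma vee_form_map_bij : bijective (@vee_form_map F L M n).
Proof.
(* The inverse expands a functional in the family [e], rescaled by [c]; agreement is checked on the
   spanning family [g]. *)
pose psi (h : dual_module (vee_module M n)) := \sum_(K in A) (h (g K) / c K) *: e K.
have psiK : cancel psi (@vee_form_map F L M n).
  move=> h; apply/eqP; rewrite -subr_eq0; set k := _ - h.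
  have: ({:vee_module M n} <= lker k)%VS.
    rewrite -g_span; apply/span_subvP => _ /mapP[J + ->].
    rewrite mem_enum => JA; rewrite memv_ker add_lfunE opp_lfunE vee_form_mapE.
    by rewrite (dual_family_coef form_linearl gram) // divfK ?c_neq0 // subrr.
  move=> /subvP k0; apply/eqP/lfunP => q; rewrite zero_lfunE.
  by apply/eqP; rewrite -memv_ker k0 ?memvf.
by exists psi => // f; apply: vee_form_map_inj; rewrite psiK.
Qed.

End Isomorphism.

(** * Parities and span of the dual basis *)

Section DualBasis.
Variables (F : fieldType) (V : superspace F).
Local Notation d0 := (sdim V false).
Local Notation d1 := (sdim V true).
Variables (v : (d0 + d1).-tuple V) (f : (d0 + d1).-tuple (dual_super V)).
Hypothesis v_even : basis_of (spart V false) (take d0 v).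
Hypothesis v_odd : basis_of (spart V true) (drop d0 v).
Hypothesis v_basis : basis_of {:V} v.
Hypothesis f_dual : forall i j, tnth f i (tnth v j) = (i == j)%:R.

Lemma homog_adapted_basis (i : 'I_(d0 + d1)) : homog V (d0 <= i)%N (tnth v i).
Proof.
apply/homog_spart; rewrite (tnth_nth 0).
case: leqP => [di|id].
  rewrite -(span_basis v_odd); apply: memv_span.
  rewrite -(subnKC di) -nth_drop mem_nth // size_drop size_tuple.
  by rewrite ltn_sub2r // (leq_ltn_trans di).
rewrite -(span_basis v_even); apply: memv_span.
by rewrite -(nth_take _ id) mem_nth // size_takel ?size_tuple ?leq_addr.
Qed.

(** A dual basis vector kills all basis vectors of the opposite parity, hence their span. *)
Lemma homog_dual_basis (i : 'I_(d0 + d1)) : homog (dual_super V) (d0 <= i)%N (tnth f i).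
Proof.
apply/homog_dual => c w /homog_spart wc ne_c.
have vj (j : 'I_(d0 + d1)) : (d0 <= j)%N = c -> tnth f i (tnth v j) = 0.
  move=> jc; rewrite f_dual; have [ij|//] := eqVneq i j.
  by move: ne_c; rewrite ij jc eqxx.
suff /subvP : (spart V c <= lker (tnth f i))%VS.
  by move/(_ _ wc); rewrite memv_ker => /eqP.
case: c ne_c wc vj => _ _ vj.
  rewrite -(span_basis v_odd); apply/span_subvP => x /(nthP 0)[k].
  rewrite size_drop size_tuple addKn nth_drop => ltk <-; rewrite memv_ker.
  have ltj : (d0 + k < d0 + d1)%N by rewrite ltn_add2l.
  by have := vj (Ordinal ltj) (leq_addr _ _); rewrite (tnth_nth 0 v) => ->.
rewrite -(span_basis v_even); apply/span_subvP => x /(nthP 0)[k].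
rewrite size_takel ?size_tuple ?leq_addr // => ltk <-; rewrite nth_take // memv_ker.
have := vj (Ordinal (ltn_addr d1 ltk)); rewrite (tnth_nth 0 v) /= => -> //.
by rewrite leqNgt ltk.
Qed.

Lemma span_dual_basis : <<f>>%VS = fullv.
Proof.
apply/vspaceP => g; rewrite memvf.
have -> : g = \sum_i g (tnth v i) *: tnth f i.
  apply/lfunP => w; rewrite (coord_basis v_basis (memvf w)) !linear_sum.
  apply: eq_bigr => j _; rewrite !linearZ /= sum_lfunE -tnth_nth; congr (_ *: _).
  rewrite (bigD1 j) //= big1 => [|i ne_ij]; rewrite scale_lfunE f_dual.
    by rewrite eqxx addr0 /GRing.scale /= mulr1.
  by rewrite (negPf ne_ij) scaler0.
by apply: rpred_sum => i _; rewrite memvZ // memv_span // mem_tnth.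
Qed.

End DualBasis.

(* In the dimension formula [.-1] is truncated: for d0 = 0 this yields the
   conventions binom(-1, 0) = 1 and binom(m - 1, m) = 0 for m >= 1. *)
Theorem mainTheorem6 (F : fieldType) (hF : 2%N \notin [pchar F])
    (L : lieSuperalgebra F) (M : supermodule L) (hM : {:M}%VS != 0%VS)
    (n : nat) (hn : (2 <= n)%N)
    (h0 : sdim M false = 0%N -> (n <= sdim M true)%N)
    (h1 : (0 < sdim M false)%N ->
      [pchar F] =i pred0 \/ exists2 p, p \in [pchar F] & (n < p)%N)
    (v : (sdim M false + sdim M true).-tuple M)
    (hv : basis_of {:M} v)
    (hv0 : basis_of (spart M false) (take (sdim M false) v))
    (hv1 : basis_of (spart M true) (drop (sdim M false) v))
    (f : (sdim M false + sdim M true).-tuple (dual_module M))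
    (hf : forall i j, tnth f i (tnth v j) = (i == j)%:R) :
  let idx := [set I : n.-tuple 'I_(sdim M false + sdim M true) | vee_index I] in
  (forall I J, I \in idx -> J \in idx ->
     vee_form (vee_family f I) (vee_family v J) =
       if I == J then kappa F I else 0) /\
  [/\ nondegenerate_pairing (@vee_form F L M n),
      basis_of {:vee_module M n} [seq vee_family v K | K <- enum idx] &
      basis_of {:vee_module (dual_module M) n}
        [seq vee_family f K | K <- enum idx]] /\
  \dim {:vee_module M n} =
    (\sum_(k < (minn (sdim M true) n).+1)
       'C(sdim M true, k) * 'C((sdim M false + (n - k)).-1, n - k))%N /\
  (dual_pairing (@vee_form F L M n) /\ supermodule_iso (@vee_form_map F L M n)).
Proof.
have two_neq0 : 2%:R != 0 :> F by apply: contraNneq hF => /eqP F2; rewrite !inE /= F2.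
have v_homog := homog_adapted_basis hv0 hv1.
have f_homog := homog_dual_basis hv0 hv1 hf.
have f_span := span_dual_basis hv hf.
move=> idx.
have gram I J : I \in idx -> J \in idx ->
    vee_form (vee_family f I) (vee_family v J) = if I == J then kappa F I else 0.
  by rewrite !inE; apply: vform_family.
have kappa_nz I : I \in idx -> kappa F I != 0.
  by rewrite inE => I_idx; apply: kappa_neq0.
have v_span := vee_family_span n two_neq0 v_homog (span_basis hv).
(* The dual basis has the same parities as [v], so the spanning result also serves the dual
   superspace. *)
have fn_span := vee_family_span n two_neq0 f_homog f_span.
have [v_bas f_bas] := vee_form_bases fn_span v_span gram kappa_nz.
have nondeg := vee_form_nondegenerate fn_span v_span gram kappa_nz.
split; first exact: gram.
split; first by split.
split; last first.
  split; first by split; [apply: vee_form_pairing | apply: nondeg].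
  split; first exact: vee_form_map_linear.
  - exact: vee_form_map_bij fn_span v_span gram kappa_nz.
  - exact: vee_form_map_homog.
  exact: vee_form_map_act.
by rewrite -(span_basis v_bas) (eqnP (basis_free v_bas)) size_map -cardE card_vee_index.
Qed.
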